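(* Suppose that Assumptions A and C hold for the $N$-player game described in the context, and that $\mathrm{VI}(X,F)$ satisfies the quadratic growth property with coefficient $\alpha>0$: $(x-x^* )^\top F(x)\ge\alpha\,\mathrm{dist}^2(x,X^* )$ for all $x\in X$ and all $x^*\in X^*$. Let $\{x^k\}_{k=0}^\infty$ be generated by the stochastic asynchronous gradient-response (SAGR) scheme with the randomized stepsizes $\gamma_i^k$ defined in the context. Let $\tilde d\in(0,\frac12)$ and $p_{\min}=\min_{i\in[N]}p_i$. Then: (i) $\lim_{k\to\infty}\mathrm{dist}(x^k,X^* )=0$ almost surely; and (ii) for sufficiently large $k$, $$\mathbb E\left[\mathrm{dist}^2(x^{k+1},X^* )\right]\ \begin{cases}\le\dfrac{3+8\sum_{i=1}^NM_{w,i}^2+11\sum_{i=1}^NM_{F,i}^2}{p_{\min}^2\,(2\alpha-1/2+\tilde d)\,k^{1/2-\tilde d}}+o\left(k^{-1/2+\tilde d}\right),&\text{if }2\alpha>1/2-\tilde d,\\[2mm]=\mathcal O\left(k^{-2\alpha}\log k\right),&\text{if }2\alpha=1/2-\tilde d,\\[1mm]=\mathcal O\left(k^{-2\alpha}\right),&\text{if }2\alpha<1/2-\tilde d.\end{cases}$$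
   Context: Game. Let $[N]=\{1,\dots,N\}$ and let $\boldsymbol{\xi}:\Omega\to\mathbb{R}^m$ be a random variable on a probability space $(\Omega,\mathcal F,\mathbb P)$ with $\Xi=\{\boldsymbol\xi(\omega)\mid\omega\in\Omega\}$. Player $i\in[N]$ has strategy set $X_i\subseteq\mathbb{R}^{n_i}$; $X=\prod_{i=1}^N X_i$, $X_{-i}=\prod_{j\ne i}X_j$, $x_{-i}=(x_j)_{j\neq i}$. Given $x_{-i}\in X_{-i}$, player $i$ solves $\min_{x_i\in X_i} f_i(x_i,x_{-i})=\mathbb E[\tilde f_i(x_i,x_{-i},\boldsymbol\xi)]$, where $\tilde f_i:X\times\Xi\to\mathbb R$. Put $F(x)=(\nabla_{x_i}f_i(x_i,x_{-i}))_{i=1}^N$. $\mathrm{VI}(X,F)$: find $x^*\in X$ with $F(x^* )^\top(x-x^* )\ge 0$ for all $x\in X$; its solution set is $X^*$ (the set of quasi-Nash equilibria of the game). $\mathrm{dist}(x,A)=\inf_{y\in A}\|y-x\|$. Assumption A. (A1) Each $X_i$ is convex and closed. (A2) For each $i$ and each $x_{-i}\in X_{-i}$, $f_i(\bullet,x_{-i})$ is $C^1$ on an open set $\mathcal O_i\supseteq X_i$ and $\nabla_{x_i}f_i(x_i,x_{-i})=\mathbb E[\nabla_{x_i}\tilde f_i(x_i,x_{-i},\boldsymbol\xi)]$. (A3) $X^*$ is closed and nonempty. SAGR scheme. Given $x^0\in X$, at each iteration $k\ge0$ a single player $i(k)$ is selected at random (independently across iterations), player $i$ being selected with probability $p_i>0$,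 $\sum_{i=1}^Np_i=1$. With a realization $\xi^k_{i(k)}$ of $\boldsymbol\xi$, player $i(k)$ updates $x_{i(k)}^{k+1}=\Pi_{X_{i(k)}}[x_{i(k)}^k-\gamma_{i(k)}^k\nabla_{x_{i(k)}}\tilde f_{i(k)}(x_{i(k)}^k,x_{-i(k)}^k,\xi_{i(k)}^k)]$, while $x_j^{k+1}=x_j^k$ for $j\ne i(k)$; $\Pi$ is Euclidean projection. Stepsizes: $\gamma_i^k=1/\Gamma_k(i)$ if $\Gamma_k(i)\neq0$ and $\gamma_i^k=0$ if $\Gamma_k(i)=0$, where $\Gamma_k(i)$ is the number of updates player $i$ has performed until and including iteration $k$. Histories: $\mathcal F_k=\sigma\{x^0,\cup_{t=0}^{k-1}\{i(t),\nabla_{x_{i(t)}}\tilde f_{i(t)}(x^t,\xi_{i(t)}^t)\}\}$ and $\mathcal F_{k+1/2}=\mathcal F_k\cup\{i(k)\}$ (the history augmented by $i(k)$). Assumption C. Let $w_{i(k)}^k=\nabla_{x_{i(k)}}\tilde f_{i(k)}(x_{i(k)}^k,x_{-i(k)}^k,\xi_{i(k)}^k)-\nabla_{x_{i(k)}}\mathbb E[\tilde f_{i(k)}(x_{i(k)}^k,x_{-i(k)}^k,\boldsymbol\xi)\mid\mathcal F_{k+1/2}]$. (C1) $\mathbb E[w_{i(k)}^k\mid\mathcal F_{k+1/2}]=0$ for all $k\ge0$. (C2) $\mathbb E[\|w_{i(k)}^k\|^2\mid\mathcal F_{k+1/2}]\le M_{w,i(k)}^2$ for all $k\ge0$, for some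 $M_{w,i(k)}>0$. (C3) For each $i\in[N]$, $\|\nabla_{x_i}f_i(x_i,x_{-i})\|\le M_{F,i}$ for all $x\in X$ and some $M_{F,i}>0$. *)

(* Defs.v *)
From HB Require Import structures.
From mathcomp Require Import all_boot all_order all_algebra.
From mathcomp Require Import all_classical all_reals all_analysis.
Set Implicit Arguments.
Unset Strict Implicit.
Unset Printing Implicit Defensive.
Import Order.TTheory GRing.Theory Num.Theory.
Import numFieldNormedType.Exports.
Local Open Scope classical_set_scope.
Local Open Scope ring_scope.

(** * Euclidean geometry

The library norm on ['rV[R]_n] is the sup norm, whence the explicit Euclidean
norm; both induce the same topology, so [closed], [open], [differentiable] and
[continuous] are the library notions. *)

Section euclid.
Context {R : realType}.

Definition dot {n} (u v : 'rV[R]_n) : R := \sum_(j < n) u 0 j * v 0 j.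

Definition enorm {n} (u : 'rV[R]_n) : R := Num.sqrt (dot u u).

Definition grad {n} (h : 'rV[R]_n -> R) (z : 'rV[R]_n) : 'rV[R]_n :=
  \row_(j < n) 'D_(delta_mx 0 j) h z.

(** Meaningful when [A] is closed, convex and nonempty, in which case the
nearest point exists and is unique. *)
Definition eproj {n} (A : set 'rV[R]_n) (z : 'rV[R]_n) : 'rV[R]_n :=
  get [set y | A y /\ forall u, A u -> enorm (z - y) <= enorm (z - u)].

End euclid.

(** * Strategy profiles [x = (x_i)_i], elements of [prod_i R^(n i)] *)

Definition profile (R : realType) (N : nat) (n : 'I_N -> nat) :=
  prod_topology (fun i : 'I_N => 'rV[R]_(n i)).

Definition borel (V : topologicalType) := g_sigma_algebraType (@open V).

Section profile.
Context {R : realType} {N : nat} {n : 'I_N -> nat}.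
Implicit Types x y : profile R n.

Definition psub x y : profile R n := fun i => x i - y i.

Definition pdot x y : R := \sum_(i < N) dot (x i) (y i).

Definition pnorm x : R := Num.sqrt (pdot x x).

Definition dist x (A : set (profile R n)) : R :=
  inf [set pnorm (psub y x) | y in A].

(** The profile [(z, x_{-i})]. *)
Definition upd x (i : 'I_N) (z : 'rV[R]_(n i)) : profile R n :=
  @dfwith 'I_N (fun k => 'rV[R]_(n k)) x i z.

(** [pgrad i h x] is the partial gradient of [h] in the block [x_i]. *)
Definition pgrad (i : 'I_N) (h : profile R n -> R) x : 'rV[R]_(n i) :=
  grad (fun z => h (upd x z)) (x i).

End profile.

(** * Conditional expectation and trace measurability *)

(** [g] is a version of the conditional expectation of [f] given the
sub-sigma-algebra [G]. *)
Definition is_cond_exp d (T : measurableType d) (R : realType)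
    (P : probability T R) (G : set (set T)) (f g : T -> R) : Prop :=
  [/\ P.-integrable setT (EFin \o f),
      P.-integrable setT (EFin \o g),
      (forall B : set R, measurable B -> G (g @^-1` B)) &
      forall A, G A ->
        (\int[P]_(w in A) (f w)%:E = \int[P]_(w in A) (g w)%:E)%E].

(** Measurability of the restriction of [f] to [D] for the trace sigma-algebra
on [D]; [measurable_fun D f] holds vacuously when [D] is not measurable, and
the range of a random variable need not be. *)
Definition trace_measurable d d' (S : measurableType d) (S' : measurableType d')
    (D : set S) (f : S -> S') : Prop :=
  forall B, measurable B ->
    exists2 C, measurable C & D `&` f @^-1` B = D `&` C.

(** * The stochastic game *)

(** [cost i] is the sampled objective of player [i]; it is a total function, but
only its values near [X * Xi] matter. *)
Record game d (T : measurableType d) (R : realType) (P : probability T R)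
    (N : nat) (n : 'I_N -> nat) (m : nat) := Game {
  strat : forall i : 'I_N, set 'rV[R]_(n i) ;
  xi : {RV P >-> borel 'rV[R]_m} ;
  cost : 'I_N -> profile R n -> 'rV[R]_m -> R }.
Arguments strat {d T R P N n m} g i _.

Section game.
Context {d} {T : measurableType d} {R : realType} {P : probability T R}.
Context {N : nat} {n : 'I_N -> nat} {m : nat}.
Variable G : game P n m.

Definition stratX : set (profile R n) := [set x | forall i, strat G i (x i)].

Definition obj (i : 'I_N) (x : profile R n) : R :=
  fine 'E_P[fun w => cost G i x (xi G w)].

Definition Fmap (x : profile R n) : profile R n := fun i => pgrad i (obj i) x.

Definition cost_grad (i : 'I_N) (x : profile R n) (s : 'rV[R]_m)
    : 'rV[R]_(n i) :=
  pgrad i (fun y => cost G i y s) x.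

(** The solution set [X^*] of [VI(X, F)]. *)
Definition solVI : set (profile R n) :=
  [set y | stratX y /\ forall x, stratX x -> 0 <= pdot (Fmap y) (psub x y)].

Definition quadratic_growth (alpha : R) : Prop :=
  forall x y, stratX x -> solVI y ->
    alpha * dist x solVI ^+ 2 <= pdot (psub x y) (Fmap x).

(** [A2_integrable], [A2_cost_diff] and [A2_cost_meas] make explicit what is
needed for the expectation defining [obj], for the sampled gradient, and for
the latter to be a random variable. *)
Record assumptionA (O : forall i : 'I_N, set 'rV[R]_(n i)) : Prop := {
  A1_convex : forall i, convex_set (strat G i) ;
  A1_closed : forall i, closed (strat G i) ;
  A2_open : forall i, open (O i) /\ strat G i `<=` O i ;
  A2_integrable : forall (i : 'I_N) (x : profile R n),
    (forall j : 'I_N, j != i -> strat G j (x j)) -> O i (x i) ->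
    P.-integrable setT (EFin \o (fun w => cost G i x (xi G w))) ;
  A2_C1 : forall (i : 'I_N) (x : profile R n),
    (forall j : 'I_N, j != i -> strat G j (x j)) -> O i (x i) ->
    differentiable (fun z => obj i (upd x z)) (x i) /\
    {for x i, continuous (grad (fun z => obj i (upd x z)))} ;
  A2_cost_diff : forall i x s, stratX x -> range (xi G) s ->
    differentiable (fun z => cost G i (upd x z) s) (x i) ;
  A2_cost_meas : forall (i : 'I_N) (j : 'I_(n i)),
    trace_measurable (S := (borel (profile R n) * borel 'rV[R]_m)%type)
      (stratX `*` range (xi G)) (fun u => cost_grad i u.1 u.2 0 j) ;
  A2_exchange : forall (i : 'I_N) x (j : 'I_(n i)), stratX x ->
    P.-integrable setT (EFin \o (fun w => cost_grad i x (xi G w) 0 j)) /\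
    (Fmap x i 0 j)%:E = 'E_P[fun w => cost_grad i x (xi G w) 0%R j]%E ;
  A3_closed : closed solVI ;
  A3_nonempty : solVI !=set0 }.

Section algorithm.
(** [sel k] is the player [i(k)], [zeta k] the realization of [xi] used at
iteration [k], and [x k] the iterate [x^k]. *)
Variables (sel : nat -> T -> 'I_N) (zeta : nat -> {RV P >-> borel 'rV[R]_m}).
Variable x : nat -> T -> profile R n.

Definition nupdates (k : nat) (i : 'I_N) (w : T) : nat :=
  (\sum_(t < k.+1) (sel t w == i))%N.

Definition stepsize (k : nat) (i : 'I_N) (w : T) : R :=
  if nupdates k i w == 0%N then 0 else 1 / (nupdates k i w)%:R.

(** Vectors living in the random space [R^(n (i(k)))] are represented by
profiles vanishing outside the block [i(k)]. *)
Definition sampled_grad (k : nat) (w : T) : profile R n := fun i =>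
  if sel k w == i then cost_grad i (x k w) (zeta k w) else 0.

(** In the conditional expectation of [cost i (x^k) xi] given F_{k+1/2}, the
random vector [xi] is independent of the history, whereas [x^k] and
[i = i(k)] are F_{k+1/2}-measurable: its value is [obj i] at [x^k]. *)
Definition noise (k : nat) (w : T) : profile R n := fun i =>
  if sel k w == i
  then cost_grad i (x k w) (zeta k w) - pgrad i (obj i) (x k w) else 0.

(** The sigma-algebras F_k and F_{k+1/2}. *)
Definition history (k : nat) : set (set T) :=
  <<s preimage_set_system setT (x 0%N : T -> borel (profile R n)) measurable
      `|` \bigcup_(t in `I_k)
        (preimage_set_system setT (sel t) setT `|`
         preimage_set_system setT
           (sampled_grad t : T -> borel (profile R n)) measurable) >>.

Definition history_half (k : nat) : set (set T) :=
  <<s history k `|` preimage_set_system setT (sel k) setT >>.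

(** Since [history k] contains the events of the earlier selections,
[sagr_sel_indep] subsumes the mutual independence of the [sel k]. *)
Record sagr (p : 'I_N -> R) : Prop := {
  sagr_p_gt0 : forall i, 0 < p i ;
  sagr_p_sum : \sum_(i < N) p i = 1 ;
  sagr_sel_meas : forall k i, measurable (sel k @^-1` [set i]) ;
  sagr_sel_law : forall k i, P (sel k @^-1` [set i]) = (p i)%:E ;
  sagr_sel_indep : forall k i A, history k A ->
    (P (A `&` sel k @^-1` [set i]) = P A * P (sel k @^-1` [set i]))%E ;
  sagr_zeta_range : forall k w, range (xi G) (zeta k w) ;
  sagr_zeta_law : forall k (B : set (borel 'rV[R]_m)), measurable B ->
    P (zeta k @^-1` B) = P (xi G @^-1` B) ;
  sagr_init : exists2 x0, stratX x0 & forall w, x 0%N w = x0 ;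
  sagr_step : forall k w, x k.+1 w =
    upd (x k w)
      (eproj (strat G (sel k w))
        (x k w (sel k w) -
         stepsize k (sel k w) w *:
           cost_grad (sel k w) (x k w) (zeta k w))) }.

Record assumptionC (Mw MF : 'I_N -> R) : Prop := {
  C1 : forall k (i : 'I_N) (j : 'I_(n i)),
    is_cond_exp P (history_half k) (fun w => noise k w i 0 j) (cst 0) ;
  C2_gt0 : forall i, 0 < Mw i ;
  C2 : forall k, exists2 g,
    is_cond_exp P (history_half k) (fun w => pnorm (noise k w) ^+ 2) g &
    {ae P, forall w, g w <= Mw (sel k w) ^+ 2} ;
  C3_gt0 : forall i, 0 < MF i ;
  C3 : forall i x, stratX x -> enorm (Fmap x i) <= MF i }.

End algorithm.
End game.

(* Main.v *)
Require Import Defs.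
From mathcomp Require Import all_boot all_order all_algebra.
From mathcomp Require Import all_classical all_reals all_analysis.
From mathcomp Require Import measurable_realfun.
From mathcomp Require Import ring lra.

(** Write [x_k] for the iterates, [D_k] for the squared distance of [x_k] to the
solution set [S], [v_k] for the vector from the nearest solution to [x_k], and
[B] for the number of updates of a player before iteration [k]. The step of the
selected player is [1 / (B + 1)].

Applied at a convex combination of two solutions, quadratic growth shows that
[S] is convex ([solVI_convex]). Hence the nearest solution depends continuously
on [x_k] and is known from the history, as is [x_k] itself ([iterate_adapted],
[gap_adapted]). A projected step does not increase distances to points of [S],
so [D_(k+1)] is at most [D_k], minus twice the inner product of the step with
[v_k], plus the squared length of the step ([sqdistS_le]). In the mean the noise
disappears, being orthogonal to the history, and the indicator of the selection
of player [i] becomes [p_i], by independence. The step size is left inside the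
expectation as the factor [p_i / (B + 1)].

The point is that [p_i / (B + 1)] is close to [1 / (k + 1)]: as [B] is binomial,
explicit inverse moments give a mean squared difference of order [k ^ (- 3)]
([bexp_fluctuation]). The arithmetic-geometric inequality, with weight
[(k + 1) ^ (3 / 2)], then turns the replacement of one by the other into an error of
order [(k + 1) ^ (- 3 / 2)], and quadratic growth yields the recursion
[e_(k+1) <= (1 - 2 alpha / (k + 1) + r) e_k + r], with [r] a multiple of
[(k + 1) ^ (- 3 / 2)], for the means [e_k] of [D_k] ([sqdist_recursion]). When
[2 alpha < 1 / 2] it implies
[e_k = O(k ^ (- 2 alpha))] ([recursion_rate]), which contains the last two rates
of the theorem. Quadratic growth is inherited by smaller coefficients, so that
when [2 alpha > 1 / 2 - dt] some [a <= alpha] has [2 a] strictly between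
[1 / 2 - dt] and [1 / 2]; then [e_k] is [o(k ^ (- 1 / 2 + dt))].

For almost sure convergence, a displacement of [x_k] has a mean square of order
[k ^ (- 2)]. Together with the decay of [e_k] this makes the mean of
[| D_(k+1) - D_k |] summable ([sqdist_summable_variation]). Almost every sequence
[D_k] therefore converges, and Fatou's lemma identifies the limit with [0]
([ae_cvg_of_summable_variation]). *)

Set Implicit Arguments.
Unset Strict Implicit.
Unset Printing Implicit Defensive.
Import Order.TTheory GRing.Theory Num.Theory.
Import numFieldNormedType.Exports.
Import HBNNSimple.
Local Open Scope classical_set_scope.
Local Open Scope ring_scope.

(** * Euclidean projection onto a closed convex set *)

Section euclid.
Context {R : realType} {n : nat}.
Implicit Types (u v w z : 'rV[R]_n) (c : R) (A : set 'rV[R]_n).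

Lemma dotC u v : dot u v = dot v u.
Proof. by apply: eq_bigr => j _; rewrite mulrC. Qed.

Lemma dotDl u v w : dot (u + v) w = dot u w + dot v w.
Proof. by rewrite -big_split; apply: eq_bigr => j _; rewrite mxE mulrDl. Qed.

Lemma dotZl c u v : dot (c *: u) v = c * dot u v.
Proof. by rewrite /dot mulr_sumr; apply: eq_bigr => j _; rewrite mxE mulrA. Qed.

Lemma dotNl u v : dot (- u) v = - dot u v.
Proof. by rewrite -scaleN1r dotZl mulN1r. Qed.

Lemma dotBl u v w : dot (u - v) w = dot u w - dot v w.
Proof. by rewrite dotDl dotNl. Qed.

Lemma dotDr u v w : dot w (u + v) = dot w u + dot w v.
Proof. by rewrite dotC dotDl !(dotC w). Qed.

Lemma dotZr c u v : dot v (c *: u) = c * dot v u.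
Proof. by rewrite dotC dotZl dotC. Qed.

Lemma dotBr u v w : dot w (u - v) = dot w u - dot w v.
Proof. by rewrite dotC dotBl !(dotC w). Qed.

Lemma dot0l u : dot 0 u = 0.
Proof. by rewrite -(scale0r u) dotZl mul0r. Qed.

Lemma dot_ge0 u : 0 <= dot u u.
Proof. by apply: sumr_ge0 => j _; rewrite -expr2 sqr_ge0. Qed.

Lemma enorm_ge0 u : 0 <= enorm u.
Proof. exact: sqrtr_ge0. Qed.

Lemma enorm_sqr u : enorm u ^+ 2 = dot u u.
Proof. by rewrite sqr_sqrtr// dot_ge0. Qed.

Lemma sqr_coord_le_dot u j : u 0 j ^+ 2 <= dot u u.
Proof.
rewrite /dot (bigD1 j)//= -expr2 lerDl; apply: sumr_ge0 => k _.
by rewrite -expr2 sqr_ge0.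
Qed.

Lemma dot_eq0 u : dot u u <= 0 -> u = 0.
Proof.
move=> u0; apply/rowP => j; rewrite mxE; apply/eqP; rewrite -sqrf_eq0.
by rewrite eq_le sqr_ge0 andbT (le_trans (sqr_coord_le_dot u j)).
Qed.

(** Expand the squared length of [dot v v *: u - dot u v *: v], which is
nonnegative. *)
Lemma cauchy_schwarz u v : dot u v ^+ 2 <= dot u u * dot v v.
Proof.
have [->|v0] := eqVneq v 0.
  by rewrite (dotC u) !dot0l mulr0 expr0n.
have v_gt0 : 0 < dot v v.
  rewrite lt_neqAle dot_ge0 andbT eq_sym; apply: contra_neq v0 => vv0.
  by apply: dot_eq0; rewrite vv0.
have := dot_ge0 (dot v v *: u - dot u v *: v).
rewrite dotBl !dotBr !dotZl !dotZr (dotC v u).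
rewrite [leRHS](_ : _ = dot v v * (dot u u * dot v v - dot u v ^+ 2)); last by ring.
by rewrite pmulr_rge0// subr_ge0.
Qed.

Lemma enorm_le_sqr u v : (enorm u <= enorm v) = (dot u u <= dot v v).
Proof. by rewrite /enorm ler_sqrt// dot_ge0. Qed.

Lemma continuous_dist_sqr z : continuous (fun u => dot (z - u) (z - u)).
Proof.
rewrite [X in continuous X](_ : _ =
  fun u => \sum_(j < n) (z 0 j - u 0 j) * (z 0 j - u 0 j)); last first.
  by apply/funext => u; apply: eq_bigr => j _; rewrite !mxE.
apply: continuous_big => [|j _]; first exact: add_continuous.
move=> u; have zuj : z 0 j - (x : 'rV[R]_n) 0 j @[x --> u] --> z 0 j - u 0 j.
  exact: (cvgB (cvg_cst _) (@coord_continuous _ _ _ 0 j u)).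
exact: (cvgM zuj zuj).
Qed.

Lemma dot_sub_scale (c : R) u v :
  dot (u - c *: v) (u - c *: v) = dot u u - c * dot u v *+ 2 + c ^+ 2 * dot v v.
Proof. by rewrite !(dotBl, dotBr, dotZl, dotZr) (dotC v u); ring. Qed.

Section projection.
Variable A : set 'rV[R]_n.
Hypotheses (A0 : A !=set0) (clA : closed A).

(** The points of [A] that are no farther from [z] than a given point of [A] form
a compact set, on which the distance to [z] attains its minimum. *)
Lemma nearest_exists z :
  exists y, A y /\ forall u, A u -> enorm (z - y) <= enorm (z - u).
Proof.
have [a Aa] := A0.
pose K := A `&` [set u | dot (z - u) (z - u) <= dot (z - a) (z - a)].
have clK : closed K.
  apply: closedI => //.
  apply: (@preimage_closed _ _ (fun u => dot (z - u) (z - u))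
    [set r | r <= dot (z - a) (z - a)]); last exact: closed_le.
  by move=> u _; exact: continuous_dist_sqr.
have bK : bounded_set K.
  exists (enorm (z - a) + `|z|); split; first exact: num_real.
  move=> M /ltW zM u [_ uz]; apply: le_trans zM.
  rewrite -(subrK z u) (le_trans (ler_normD _ _))// lerD2r.
  rewrite [leLHS]/Num.norm/= mx_normrE; apply/bigmax_leP; split => [|[i j] _].
    exact: enorm_ge0.
  rewrite /= (ord1 i) -(ler_sqr (normr_ge0 _) (enorm_ge0 _)) real_normK ?num_real//.
  rewrite enorm_sqr (le_trans _ uz)// (_ : _ ^+ 2 = (z - u) 0 j ^+ 2).
    exact: sqr_coord_le_dot.
  by rewrite !mxE; ring.
have [||y yK ymin] := @EVT_min_rV R n (fun u => dot (z - u) (z - u)) K _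
    (bounded_closed_compact bK clK).
- by exists a; split => /=.
- exact/continuous_subspaceT/continuous_dist_sqr.
have [Ay yza] := set_mem yK; exists y; split => // u Au; rewrite enorm_le_sqr.
have [uza|/ltW auz] := leP (dot (z - u) (z - u)) (dot (z - a) (z - a)).
  by apply: ymin; rewrite inE.
exact: le_trans auz.
Qed.

Lemma eprojP z : A (eproj A z) /\
  forall u, A u -> enorm (z - eproj A z) <= enorm (z - u).
Proof. exact: (getPex (nearest_exists z)). Qed.

Lemma eproj_id z : A z -> eproj A z = z.
Proof.
move=> Az; have [_ /(_ z Az)] := eprojP z.
rewrite enorm_le_sqr subrr => /le_trans h; apply/esym/eqP.
rewrite -subr_eq0; apply/eqP/dot_eq0/h.
by rewrite dot0l.
Qed.

Hypothesis cvxA : forall u v t, A u -> A v -> 0 <= t <= 1 ->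
  A (t *: u + (1 - t) *: v).

(** Otherwise a short enough step [t] from the projection [y] towards [u] would
stay in [A] and come closer to [z]. *)
Lemma eproj_obtuse z u : A u -> dot (z - eproj A z) (u - eproj A z) <= 0.
Proof.
move=> Au; have [AP minP] := eprojP z; set y := eproj A z in AP minP *.
set q := dot (u - y) (u - y); set s := dot _ _; rewrite leNgt; apply/negP => s0.
have q0 : 0 <= q := dot_ge0 _.
(* This step satisfies [t * q < 2 * s], the condition for a strict decrease. *)
pose t := s / (s + q).
have sq0 : 0 < s + q by rewrite ltr_wpDr.
have t0 : 0 < t by rewrite divr_gt0.
have t1 : t <= 1 by rewrite ler_pdivrMr// mul1r lerDl.
have := minP _ (cvxA Au AP (_ : 0 <= t <= 1)); rewrite (ltW t0) t1 => /(_ isT).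
have -> : z - (t *: u + (1 - t) *: y) = (z - y) - t *: (u - y).
  by apply/rowP => j; rewrite !mxE; ring.
rewrite enorm_le_sqr dot_sub_scale -/q -/s.
have tq : t * q < s *+ 2.
  rewrite (@le_lt_trans _ _ s)//; last by rewrite mulr2n ltrDl.
  by rewrite /t mulrAC ler_pdivrMr// ler_wpM2l// ?lerDr ltW.
rewrite leNgt => /negP; apply; rewrite -subr_lt0.
set e := dot (z - y) _; rewrite (_ : _ - e = t * (t * q - s *+ 2)); last by ring.
by rewrite pmulr_rlt0// subr_lt0.
Qed.

(** Add the two obtuse-angle inequalities at the projections of [z] and [w], then
apply the Cauchy-Schwarz inequality. *)
Lemma eproj_nonexpansive z w :
  dot (eproj A z - eproj A w) (eproj A z - eproj A w) <= dot (z - w) (z - w).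
Proof.
have [[Az _] [Aw _]] := (eprojP z, eprojP w).
have h1 := eproj_obtuse z Aw; have h2 := eproj_obtuse w Az.
set a := eproj A z in h1 h2 *; set b := eproj A w in h1 h2 *.
have hab : dot (a - b) (a - b) <= dot (z - w) (a - b).
  rewrite -subr_ge0 -dotBl -(oppr_le0).
  apply: le_trans (_ : dot (z - a) (b - a) + dot (w - b) (a - b) <= 0); last first.
    by rewrite -(addr0 0) lerD.
  by rewrite !(dotBl, dotBr) le_eqVlt; apply/orP; left; apply/eqP; ring.
have [->|ab0] := eqVneq (dot (a - b) (a - b)) 0; first exact: dot_ge0.
have ab_gt0 : 0 < dot (a - b) (a - b) by rewrite lt_neqAle eq_sym ab0 dot_ge0.
rewrite -(ler_pM2r ab_gt0) (le_trans _ (cauchy_schwarz _ _))//.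
by rewrite expr2 ler_pM// ltW.
Qed.

(** Projecting onto [A] does not increase the distance to a point of [A]: this is
how a projected gradient step is compared with a solution. *)
Lemma eproj_fejer z u : A u ->
  dot (eproj A z - u) (eproj A z - u) <= dot (z - u) (z - u).
Proof. by move=> Au; have := eproj_nonexpansive z u; rewrite (eproj_id Au). Qed.

End projection.

Lemma dotNN u : dot (- u) (- u) = dot u u.
Proof. by rewrite dotNl dotC dotNl opprK. Qed.

Lemma dot_sub_sym u v : dot (u - v) (u - v) = dot (v - u) (v - u).
Proof. by rewrite -opprB dotNN. Qed.

Lemma dot_add_sqr_le u v : dot (u + v) (u + v) <= 2 * dot u u + 2 * dot v v.
Proof.
have := dot_ge0 (u - v); rewrite !(dotBl, dotBr, dotDl, dotDr) (dotC v u); lra.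
Qed.

Lemma norm_dot_le u v c : 0 <= c -> enorm u <= c -> `|dot u v| <= c * enorm v.
Proof.
move=> c0 uc; rewrite -ler_sqr ?nnegrE ?normr_ge0 ?mulr_ge0 ?enorm_ge0//.
rewrite real_normK ?num_real// (le_trans (cauchy_schwarz u v))// exprMn.
rewrite -!enorm_sqr ler_wpM2r ?sqr_ge0//.
by rewrite ler_sqr ?nnegrE ?enorm_ge0.
Qed.

End euclid.

(** The topology of row vectors is that of the sup norm, hence the detour through
coordinates; projections enter measurability arguments through this lemma. *)
Lemma nonexpansive_coord_continuous (R : realType) (m n : nat)
    (f : 'rV[R]_m -> 'rV[R]_n) j :
  (forall u v, dot (f u - f v) (f u - f v) <= dot (u - v) (u - v)) ->
  continuous (fun u => f u 0 j).
Proof.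
move=> fle u; apply/(@cvgrPdist_lt _ _ _ _ (nbhs_filter u)) => e e0.
have := cvgr_lt _ (@continuous_dist_sqr _ _ u u).
have -> : dot (u - u) (u - u) = 0.
  by rewrite subrr dot0l.
move=> /(_ (nbhs_filter u) _ (exprn_gt0 2 e0)); apply: (@filterS _ _ (nbhs_filter u)) => v uv.
rewrite -ltr_sqr ?nnegrE ?(ltW e0)// real_normK ?num_real//.
apply: le_lt_trans uv; apply: le_trans (fle u v).
by have := sqr_coord_le_dot (f u - f v) j; rewrite !mxE.
Qed.

(** * Profiles as row vectors *)

Section pack.
Context {R : realType} {N : nat} {n : 'I_N -> nat}.
Implicit Types x y : profile R n.

(** Concatenation of the blocks, an isometry through which the projection and
Borel theories of row vectors apply to profiles. *)
Definition pack x : 'rV[R]_(\sum_i n i) := \mxrow_i x i.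

Definition unpack (u : 'rV[R]_(\sum_i n i)) : profile R n :=
  fun i => submxrow u i.

Lemma packK : cancel pack unpack.
Proof. by move=> x; apply: functional_extensionality_dep => i; exact: mxrowK. Qed.

Lemma unpackK : cancel unpack pack.
Proof. by move=> u; exact: submxrowK. Qed.

Lemma dotE m (u v : 'rV[R]_m) : dot u v = (u *m v^T) 0 0.
Proof. by rewrite mxE; apply: eq_bigr => j _; rewrite mxE. Qed.

Lemma pdotE x y : pdot x y = dot (pack x) (pack y).
Proof.
rewrite dotE /pack tr_mxrow mul_mxrow_mxcol summxE.
by apply: eq_bigr => i _; rewrite dotE.
Qed.

Lemma pack_psub x y : pack (psub x y) = pack x - pack y.
Proof. by rewrite /pack -mxrowN -mxrowD. Qed.

Lemma pnormE x : pnorm x = enorm (pack x).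
Proof. by rewrite /pnorm pdotE. Qed.

Lemma pnorm_sqr x : pnorm x ^+ 2 = pdot x x.
Proof. by rewrite pnormE enorm_sqr pdotE. Qed.

Lemma submxrow_continuous i :
  continuous (fun u : 'rV[R]_(\sum_i n i) => submxrow u i).
Proof.
move=> u A /nbhs_ballP[e /= e0 eA]; apply/nbhs_ballP; exists e => //= v [_ uv].
by apply: eA; split => // k j; rewrite !mxE; exact: uv.
Qed.

Lemma unpack_continuous : continuous unpack.
Proof.
move=> u; have F : Filter (unpack @ u) by exact: (fmap_filter _ (nbhs_filter u)).
apply/(@cvg_sup _ _ _ _ _ F) => i A [B [[C oC <-] uC CA]].
apply: (@filterS _ _ _ (unpack @^-1` (@^~ i @^-1` C))).
  exact: preimage_subset.
apply: (@submxrow_continuous i u).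
by apply: open_nbhs_nbhs; split.
Qed.

Lemma profile_coord_continuous i (j : 'I_(n i)) :
  continuous (fun x : profile R n => x i 0 j).
Proof.
move=> x; apply: (@continuous_comp _ _ _ (fun x : profile R n => x i)
  (fun u => u 0 j)); last exact: coord_continuous.
exact: (@proj_continuous _ (fun k => 'rV[R]_(n k)) i x).
Qed.

(** The nearest point of [S]; for the projection theory profiles are read as
row vectors of length the sum of all dimensions. *)
Definition pproj (S : set (profile R n)) x : profile R n :=
  unpack (eproj (unpack @^-1` S) (pack x)).

Section pproj.
Variable S : set (profile R n).
Hypotheses (clS : closed S) (S0 : S !=set0).

Let clS' : closed (unpack @^-1` S).
Proof. by apply: preimage_closed => // u _; exact: unpack_continuous. Qed.

Let S0' : (unpack @^-1` S) !=set0.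
Proof. by have [y Sy] := S0; exists (pack y); rewrite /preimage/= packK. Qed.

Lemma pproj_mem x : S (pproj S x).
Proof. by have [] := eprojP S0' clS' (pack x). Qed.

Lemma dist_pproj x : dist x S = pnorm (psub x (pproj S x)).
Proof.
have [_ minP] := eprojP S0' clS' (pack x).
have distC y z : pnorm (psub y z) = pnorm (psub z y).
  by rewrite !pnormE !pack_psub /enorm -opprB dotNl dotC dotNl opprK.
have lb y : S y -> pnorm (psub x (pproj S x)) <= pnorm (psub y x).
  move=> Sy; rewrite (distC y) !pnormE !pack_psub unpackK; apply: minP.
  by rewrite /preimage/= packK.
apply/eqP; rewrite eq_le; apply/andP; split.
  apply: ge_inf; last by exists (pproj S x); [exact: pproj_mem|exact: distC].
  by exists 0 => _ [y _ <-]; exact: sqrtr_ge0.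
apply: lb_le_inf; first by have [y Sy] := S0; exists (pnorm (psub y x)), y.
by move=> _ [y Sy <-]; exact: lb.
Qed.

Lemma dist_sqr_le x y : S y -> dist x S ^+ 2 <= pdot (psub x y) (psub x y).
Proof.
move=> Sy; have [_ minP] := eprojP S0' clS' (pack x).
rewrite dist_pproj pnorm_sqr !pdotE !pack_psub unpackK -enorm_le_sqr.
by apply: minP; rewrite /preimage/= packK.
Qed.

Hypothesis cvxS : forall x y t, S x -> S y -> 0 <= t <= 1 ->
  S (fun i => t *: x i + (1 - t) *: y i).

Lemma pproj_nonexpansive x y :
  dot (pack (pproj S x) - pack (pproj S y)) (pack (pproj S x) - pack (pproj S y))
  <= dot (pack x - pack y) (pack x - pack y).
Proof.
rewrite !unpackK; apply: eproj_nonexpansive => // u v t Su Sv t01.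
rewrite /preimage/= (_ : unpack _ = fun i => t *: unpack u i + (1 - t) *: unpack v i).
  exact: cvxS.
by apply: functional_extensionality_dep => i; apply/rowP => j; rewrite !mxE.
Qed.

End pproj.
End pack.

(** * Borel measurability of vectors and profiles *)

Section borel.
Context {R : realType}.

Lemma borel_measurable_continuous (V : ptopologicalType) (h : V -> R) :
  continuous h -> measurable_fun [set: borel V] (h : borel V -> R).
Proof.
move=> /continuousP ch; apply: (measurability _ (RGenOpens.measurableE R)).
move=> _ [_ [a [b ->] <-]]; rewrite setTI; apply: sub_sigma_algebra.
exact/ch/interval_open.
Qed.

Context d {S : measurableType d}.

(** Every open set of row vectors is the union of the balls with rational
centre and radius that it contains, and such a ball is a box. *)
Lemma measurable_row k (u : S -> 'rV[R]_k) :
  (forall j, measurable_fun setT (fun w => u w 0 j)) ->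
  measurable_fun setT (u : S -> borel 'rV[R]_k).
Proof.
move=> mu; apply: (@measurability _ _ S (borel 'rV[R]_k) setT u open) => // _ [U oU <-].
rewrite setTI.
pose B (q : 'rV[rat]_k * rat) : set 'rV[R]_k :=
  ball (map_mx ratr q.1 : 'rV[R]_k) (ratr q.2 : R).
have -> : u @^-1` U =
    \bigcup_q (if `[< B q `<=` U >] then u @^-1` B q else set0).
  apply/seteqP; split => [w|w [q _]]; last by case: asboolP => // BU; exact: BU.
  move=> /= Uw; have /nbhs_ballP[e /= e0 eU] : nbhs (u w) U by exact: open_nbhs_nbhs.
  have [r] := rat_in_itvoo (divr_gt0 e0 (ltr0n R 2)).
  rewrite in_itv/= => /andP[r0 re].
  have /(_ _)/cid-/(all_sig) [c cP] j : exists q : rat, `|u w 0 j - ratr q| < ratr r.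
    have [q] := @rat_in_itvoo R (u w 0 j - ratr r) (u w 0 j) ltac:(by rewrite ltrBlDr ltrDl).
    rewrite in_itv/= => /andP[q1 q2]; exists q.
    by rewrite gtr0_norm ?subr_gt0// ltrBlDr addrC -ltrBlDr.
  exists ((\row_j c j), r) => //.
  have Bw : B (\row_j c j, r) (u w).
    by split => // i j; rewrite (ord1 i) !mxE /ball/= distrC.
  case: asboolP => // -[] v Bv; apply: eU.
  have := ball_triangle (ball_sym Bw) Bv; apply: le_ball => /=; lra.
apply: countable_bigcupT_measurable => // q.
case: ifPn => // _; rewrite /B.
have [q0|q0] := leP (ratr q.2 : R) 0.
  rewrite (_ : _ @^-1` _ = set0)//; apply/seteqP; split => // w [].
  by rewrite ltNge q0.
have -> : u @^-1` ball (map_mx ratr q.1 : 'rV[R]_k) (ratr q.2 : R) =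
    \bigcap_(j in [set: 'I_k]) ((fun w => u w 0 j) @^-1`
      `]ratr (q.1 0 j) - ratr q.2, ratr (q.1 0 j) + ratr q.2[%classic).
  apply/seteqP; split => w /= Bw.
    move=> j _ /=; have := Bw.2 0 j.
    by rewrite !mxE /ball/= in_itv/= ltr_distlC.
  split => // i j; rewrite (ord1 i); have := Bw j I.
  by rewrite /= !mxE /ball/= in_itv/= ltr_distlC.
apply: fin_bigcap_measurable => // j _.
by rewrite -[X in measurable X]setTI; exact: mu.
Qed.

(** Preimages of open sets of profiles are preimages, under the concatenated
vector, of open sets of row vectors. *)
Lemma measurable_profile N (n : 'I_N -> nat) (x : S -> profile R n) :
  (forall i j, measurable_fun setT (fun w => x w i 0 j)) ->
  measurable_fun setT (x : S -> borel (profile R n)).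
Proof.
move=> mx; apply: (@measurability _ _ S (borel (profile R n)) setT x
  (@open (profile R n))) => //.
move=> _ [U oU <-]; rewrite setTI.
have oU' : open (unpack @^-1` U).
  by move/continuousP : (@unpack_continuous R N n); exact.
have mpack : measurable_fun setT (fun w => pack (x w) : borel _).
  apply: measurable_row => j; rewrite (_ : (fun _ => _) =
    fun w => x w (tagnat.sig1 j) 0 (tagnat.sig2 j)); first exact: mx.
  by apply/funext => w; rewrite mxE.
rewrite (_ : x @^-1` U = (fun w => pack (x w)) @^-1` (unpack @^-1` U)); last first.
  by apply/seteqP; split => w; rewrite /preimage/= packK.
rewrite -[X in measurable X]setTI; apply: mpack => //.
exact: sub_sigma_algebra.
Qed.

Lemma measurable_profile_coord N (n : 'I_N -> nat) (x : S -> profile R n) i j :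
  measurable_fun setT (x : S -> borel (profile R n)) ->
  measurable_fun setT (fun w => x w i 0 j).
Proof.
move=> mx; pose h (y : borel (profile R n)) : R := y i 0 j.
suff mh : measurable_fun setT h by exact: (measurableT_comp mh mx).
apply: (measurability _ (RGenOpens.measurableE R)) => _ [_ [a [b ->] <-]].
rewrite setTI; apply: sub_sigma_algebra.
move/continuousP : (@profile_coord_continuous R N n i j); apply.
exact: interval_open.
Qed.

End borel.

(** * Expectations, orthogonality to a sub-sigma-algebra, trace measurability *)

Section expectation.
Context d {T : measurableType d} {R : realType} (P : probability T R).
Implicit Types (f g h : T -> R) (c : R).

Definition L1 f := P.-integrable setT (EFin \o f).

Definition Ex f : R := \int[P]_w f w.

Lemma L1_meas f : L1 f -> measurable_fun setT f.
Proof. by move=> /integrableP[/measurable_EFinP]. Qed.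

Lemma L1D f g : L1 f -> L1 g -> L1 (fun w => f w + g w).
Proof. exact: integrableD. Qed.

Lemma L1B f g : L1 f -> L1 g -> L1 (fun w => f w - g w).
Proof. exact: integrableB. Qed.

Lemma L1Z c f : L1 f -> L1 (fun w => c * f w).
Proof. exact: integrableZl. Qed.

Lemma L1_sum I (s : seq I) (p : pred I) (f : I -> T -> R) :
  (forall i, p i -> L1 (f i)) -> L1 (fun w => \sum_(i <- s | p i) f i w).
Proof.
move=> h; rewrite /L1 (_ : EFin \o _ =
  fun w => (\sum_(i <- s | p i) (f i w)%:E)%E); first exact: integrable_sum.
by apply/funext => w /=; rewrite sumEFin.
Qed.

Lemma L1_cst c : L1 (fun _ => c).
Proof. exact: finite_measure_integrable_cst. Qed.

Lemma L1_le f g : measurable_fun setT f -> L1 g ->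
  (forall w, `|f w| <= g w) -> L1 f.
Proof.
move=> mf ig fg; apply: (@le_integrable _ _ _ P setT measurableT (EFin \o f)
  (EFin \o g)) => //; first exact/measurable_EFinP.
by move=> w _ /=; rewrite lee_fin (le_trans (fg w)) ?ler_norm.
Qed.

Lemma L1_norm f : L1 f -> L1 (fun w => `|f w|).
Proof. exact: integrable_norm. Qed.

Lemma L1_bounded c f : measurable_fun setT f -> (forall w, `|f w| <= c) -> L1 f.
Proof. by move=> mf; apply: L1_le => //; exact: L1_cst. Qed.

Lemma L1M_bounded c f h : L1 f -> measurable_fun setT h ->
  (forall w, `|h w| <= c) -> L1 (fun w => f w * h w).
Proof.
move=> intf mh hc; apply: L1_le (L1Z c (L1_norm intf)) _.
  by apply: measurable_funM => //; exact: L1_meas.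
by move=> w; rewrite normrM mulrC ler_wpM2r.
Qed.

Lemma Ex_EFin f : L1 f -> (\int[P]_w (f w)%:E = (Ex f)%:E)%E.
Proof. by move=> /(integrable_fin_num measurableT) h; rewrite /Ex /Rintegral fineK. Qed.

Lemma ExD f g : L1 f -> L1 g -> Ex (fun w => f w + g w) = Ex f + Ex g.
Proof. exact: RintegralD. Qed.

Lemma ExB f g : L1 f -> L1 g -> Ex (fun w => f w - g w) = Ex f - Ex g.
Proof. exact: RintegralB. Qed.

Lemma ExZ c f : L1 f -> Ex (fun w => c * f w) = c * Ex f.
Proof. exact: RintegralZl. Qed.

Lemma Ex_cst c : Ex (fun _ => c) = c.
Proof. apply: EFin_inj; rewrite -Ex_EFin; last exact: L1_cst.
by rewrite integral_cst// [X in (_ * X)%E]probability_setT mule1. Qed.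

Lemma Ex_sum I (s : seq I) (p : pred I) (f : I -> T -> R) :
  (forall i, L1 (f i)) ->
  Ex (fun w => \sum_(i <- s | p i) f i w) = \sum_(i <- s | p i) Ex (f i).
Proof.
move=> h; apply: EFin_inj; rewrite -Ex_EFin; last exact: L1_sum.
rewrite -sumEFin; under eq_integral do rewrite -sumEFin.
by rewrite integral_sum//; apply: eq_bigr => i _; rewrite Ex_EFin.
Qed.

Lemma le_Ex f g : L1 f -> L1 g -> (forall w, f w <= g w) -> Ex f <= Ex g.
Proof. by move=> intf intg fg; apply: le_Rintegral. Qed.

(** The positive part of [f - g] vanishes almost everywhere. *)
Lemma le_Ex_ae f g : L1 f -> L1 g -> {ae P, forall w, f w <= g w} ->
  Ex f <= Ex g.
Proof.
move=> intf intg fg.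
have intm : L1 (fun w => Num.max (f w - g w) 0).
  apply: L1_le (L1_norm (L1B intf intg)) _.
    by apply: measurable_maxr => //; exact: (L1_meas (L1B intf intg)).
  by move=> w; rewrite /Order.max; case: ifP => // _; rewrite normr0.
have m0 : Ex (fun w => Num.max (f w - g w) 0) = 0.
  apply: EFin_inj; rewrite -Ex_EFin//.
  transitivity (\int[P]_(w in setT) (0 : \bar R))%E; last exact: integral0.
  apply: ae_eq_integral => //; first exact/measurable_EFinP/L1_meas.
  by apply: filterS fg => w fgw _ /=; rewrite max_r// subr_le0.
rewrite -[Ex g]addr0 -m0 -ExD//; apply: le_Ex => //; first exact: L1D.
by move=> w; rewrite -lerBlDl le_max lexx.
Qed.

Lemma Ex_ge0 f : (forall w, 0 <= f w) -> 0 <= Ex f.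
Proof. by move=> f0; exact: Rintegral_ge0. Qed.

(** Approximate [h] by simple functions of the sub-sigma-algebra, on each of
which the integral vanishes by linearity. *)
Lemma Ex_orthogonal (G : set (set T)) f h :
  <<s G >> `<=` measurable ->
  L1 f -> (forall A, <<s G >> A -> (\int[P]_(w in A) (f w)%:E = 0)%E) ->
  measurable_fun setT (h : g_sigma_algebraType G -> R) ->
  L1 (fun w => f w * h w) -> Ex (fun w => f w * h w) = 0.
Proof.
move=> Gm intf f0.
have subm g : measurable_fun setT (g : g_sigma_algebraType G -> R) ->
    measurable_fun setT g.
  by move=> mg _ B mB; apply: Gm; have := mg measurableT B mB.
suff pos g : (forall w, 0 <= g w) ->
    measurable_fun setT (g : g_sigma_algebraType G -> R) ->
    L1 (fun w => f w * g w) -> Ex (fun w => f w * g w) = 0.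
  move=> mh fh.
  have fhp : L1 (fun w => f w * Num.max (h w) 0).
    apply: L1_le (L1_norm fh) _.
      by apply: measurable_funM; [exact: L1_meas | apply/subm/measurable_maxr].
    move=> w; rewrite !normrM ler_wpM2l//.
    by rewrite /Order.max; case: ifP => // _; rewrite normr0.
  have fhn : L1 (fun w => f w * Num.max (- h w) 0).
    apply: L1_le (L1_norm fh) _.
      apply: measurable_funM; first exact: L1_meas.
      by apply/subm/measurable_maxr => //; exact: measurableT_comp.
    move=> w; rewrite !normrM ler_wpM2l// -(normrN (h w)).
    by rewrite /Order.max; case: ifP => // _; rewrite normr0.
  rewrite (_ : (fun w => _) = fun w =>
    f w * Num.max (h w) 0 - f w * Num.max (- h w) 0).
    rewrite ExB// !pos ?subr0//.
    - by move=> w; rewrite le_max lexx orbT.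
    - by apply: measurable_maxr => //; exact: measurableT_comp.
    - by move=> w; rewrite le_max lexx orbT.
    - exact: measurable_maxr.
  apply/funext => w; rewrite -mulrBr; congr (_ * _).
  by case: leP => h1; case: leP => h2; lra.
move=> g0 mg fg.
have mEg : measurable_fun setT (EFin \o g : g_sigma_algebraType G -> \bar R).
  exact/measurable_EFinP.
pose s := nnsfun_approx measurableT mEg.
have ndg w : {homo (fun k => s k w) : i j / (i <= j)%N >-> i <= j}.
  by move=> i j ij; have /lefP := nd_nnsfun_approx measurableT mEg ij; exact.
have cvs w : (fun k => s k w) @ \oo --> g w.
  apply: (@fine_cvg _ _ _ _ (EFin \o (fun k => s k w)) (g w)).
  apply: (cvg_nnsfun_approx measurableT mEg) => // v _.
  by rewrite lee_fin.
have sg k w : s k w <= g w.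
  rewrite -(cvg_lim (@Rhausdorff R) (cvs w)).
  by apply: nondecreasing_cvgn_le; [exact: ndg | apply/cvg_ex; exists (g w)].
have ms k : measurable_fun setT (s k : T -> R) by apply: subm.
have fs k : L1 (fun w => f w * s k w).
  apply: L1_le (L1_norm fg) _; first by apply: measurable_funM => //; exact: L1_meas.
  by move=> w; rewrite !normrM ler_wpM2l// !ger0_norm.
have s0 k : (\int[P]_w (f w * s k w)%:E = 0)%E.
  have fin : finite_set (range (s k)) by exact: fimfunP.
  have mA y : <<s G >> (s k @^-1` [set y]) by exact: (measurable_sfunP (s k)).
  have fA y : L1 (fun w => f w * \1_(s k @^-1` [set y]) w).
    apply: L1_le (L1_norm intf) _.
      apply: measurable_funM; first exact: L1_meas.
      by apply: measurable_indic; apply: Gm; exact: mA.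
    by move=> w; rewrite normrM ler_piMr// indicE; case: (_ \in _); rewrite ?normr1 ?normr0.
  rewrite (_ : (fun w => _) = fun w => (\sum_(y <- finmap.enum_fset (fset_set (range (s k))))
      y%:E * (f w * \1_(s k @^-1` [set y]) w)%:E)%E); last first.
    apply/funext => w; rewrite {1}fimfunE fsbig_finite//= mulr_sumr -sumEFin.
    by apply: eq_bigr => y _; rewrite -EFinM; congr EFin; ring.
  rewrite integral_sum//; last by move=> y; apply: integrableZl => //; exact: fA.
  rewrite big1// => y _; rewrite integralZl//; last exact: fA.
  rewrite [X in (_ * X)%E](_ : _ = 0)%E ?mule0//.
  rewrite -(f0 _ (mA y)) [RHS]integral_mkcond; apply: eq_integral => w _.
  rewrite patchE indicE; case: ifPn => wA; rewrite ?mulr1 ?mulr0//.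
apply: EFin_inj; rewrite -Ex_EFin//.
have [|||||_ _] := @dominated_convergence _ _ _ P setT measurableT
  (fun k w => (f w * s k w)%:E) (fun w => (f w * g w)%:E)
  (fun w => `|f w * g w|%:E); last first.
- rewrite (_ : [sequence _]_n = fun=> 0%E); last by apply/funext => k; exact: s0.
  by move=> cv0; apply/esym/(cvg_unique _ _ cv0) => //; exact: cvg_cst.
- apply: aeW => w k _; rewrite /= lee_fin !normrM ler_wpM2l// !ger0_norm//.
- exact: L1_norm.
- by apply: aeW => w _; apply: cvg_EFin; [exact: nearW|apply: cvgMr].
- exact/measurable_EFinP/L1_meas.
- by move=> k; exact/measurable_EFinP/L1_meas/fs.
Qed.

End expectation.

Section trace_measurability.
Context {R : realType}.

(** The extension is the supremum of the rationals [q] such that the argument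
lies in a measurable set that cuts out [f > q] on [D]. *)
Lemma trace_measurable_extension d (S : measurableType d) (D : set S)
    (f : S -> R) : trace_measurable D f ->
  exists2 c : S -> \bar R, measurable_fun setT c &
    forall u, D u -> c u = (f u)%:E.
Proof.
move=> tf.
have /(_ _)/cid2-/(all_sig2) [C mC DC] q : exists2 C : set S, measurable C &
    D `&` f @^-1` `](ratr q : R), +oo[ = D `&` C by apply: tf.
pose c u := ereal_sup [set ((ratr q : R)%:E) | q in [set q | C q u]].
exists c.
  apply: (measurability _ (ErealGenOInfty.measurableE R)) => _ [_ [a ->] <-].
  rewrite setTI (_ : _ @^-1` _ =
      \bigcup_q (if a < ratr q then C q else set0)); last first.
    apply/seteqP; split => u /=.
      rewrite in_itv/= andbT => /ereal_sup_gt[_ [q Cq <-]]; rewrite lte_fin => aq.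
      by exists q => //; rewrite aq.
    move=> [q _]; case: ifPn => // aq Cq; rewrite in_itv/= andbT.
    apply: (@lt_le_trans _ _ (ratr q)%:E); first by rewrite lte_fin.
    by apply: ereal_sup_ubound; exists q.
  by apply: countable_bigcupT_measurable => // q; case: ifP.
move=> u Du; have Cf q : C q u <-> ratr q < f u.
  have : (D `&` f @^-1` `](ratr q : R), +oo[) u <-> (D `&` C q) u by rewrite DC.
  by rewrite /setI/= in_itv/= andbT; tauto.
apply/eqP; rewrite eq_le; apply/andP; split.
  by apply: ge_ereal_sup => _ [q /Cf qf <-]; rewrite lee_fin ltW.
apply/lee_addgt0Pr => e e0; rewrite -leeBlDr//.
have [q] := @rat_in_itvoo R (f u - e) (f u) ltac:(by rewrite ltrBlDr ltrDl).
rewrite in_itv/= => /andP[q1 q2].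
apply: (@le_trans _ _ (ratr q)%:E); first by rewrite -EFinB lee_fin ltW.
by apply: ereal_sup_ubound; exists q => //; exact/Cf.
Qed.

(** By Tonelli's theorem the positive and negative parts of an extension of [f],
integrated along [Y], are measurable in their first argument; this is what makes
the map [F] of a game a measurable function of the strategies. *)
Lemma trace_measurable_Ex d1 d2 d3 (T : measurableType d3)
    (P : probability T R) (S1 : measurableType d1) (S2 : measurableType d2)
    (D : set S1) (Y : T -> S2) (f : S1 * S2 -> R) :
  measurable_fun setT Y -> trace_measurable (D `*` range Y) f ->
  exists2 g : S1 -> R, measurable_fun setT g &
    forall x, D x -> L1 P (fun w => f (x, Y w)) ->
      g x = Ex P (fun w => f (x, Y w)).
Proof.
move=> mY /trace_measurable_extension[c mc cf].
have mcY : measurable_fun setT (fun z : S1 * T => c (z.1, Y z.2)).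
  apply: (measurableT_comp mc).
  by apply: measurable_fun_pair => //; exact: (measurableT_comp mY measurable_snd).
pose F (e : \bar R -> \bar R) x := (\int[P]_w e (c (x, Y w)))%E.
exists (fun x => fine (F (maxe^~ 0%E) x) - fine (F (fun y => maxe (- y) 0)%E x)).
  apply: measurable_funB; apply: (measurableT_comp (fine_measurable measurableT)).
    apply: (@measurable_fun_fubini_tonelli_F _ _ _ _ _ P (fun z => maxe (c (z.1, Y z.2)) 0%E)).
      exact: measurable_maxe.
    by move=> z; rewrite le_max lexx orbT.
  apply: (@measurable_fun_fubini_tonelli_F _ _ _ _ _ P (fun z => maxe (- c (z.1, Y z.2)) 0)%E).
    by apply: measurable_maxe => //; exact: measurableT_comp.
  by move=> z; rewrite le_max lexx orbT.
move=> x Dx intf; apply: EFin_inj; rewrite -Ex_EFin// integralE.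
have cE w : c (x, Y w) = (f (x, Y w))%:E by apply: cf; split => //; exists w.
rewrite EFinB /F; congr (_ - _)%E.
  rewrite (_ : (\int[P]_w maxe (c (x, Y w)) 0)%E =
      (\int[P]_w (EFin \o (fun w => f (x, Y w)))^\+ w)%E).
    by rewrite fineK//; exact: (integrable_pos_fin_num measurableT intf).
  by apply: eq_integral => w _; rewrite cE funeposE.
rewrite (_ : (\int[P]_w maxe (- c (x, Y w)) 0)%E =
    (\int[P]_w (EFin \o (fun w => f (x, Y w)))^\- w)%E).
  by rewrite fineK//; exact: (integrable_neg_fin_num measurableT intf).
by apply: eq_integral => w _; rewrite cE funenegE.
Qed.

End trace_measurability.

(** * Inverse moments of binomial variables *)

Section binomial_moments.
Context {R : realType}.
Implicit Types (p : R) (g h : nat -> R) (k : nat).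

(** The mean of [g] under the binomial law of parameters [k] and [p],
computed by conditioning on the first trial. *)
Fixpoint bexp p k g : R :=
  if k is k'.+1 then p * bexp p k' (fun b => g b.+1) + (1 - p) * bexp p k' g
  else g 0%N.

Lemma eq_bexp p k g h : g =1 h -> bexp p k g = bexp p k h.
Proof. by move=> /funext ->. Qed.

Lemma bexpD p k g h : bexp p k (fun b => g b + h b) = bexp p k g + bexp p k h.
Proof. by elim: k g h => //= k IH g h; rewrite !IH; ring. Qed.

Lemma bexpZ p k (c : R) g : bexp p k (fun b => c * g b) = c * bexp p k g.
Proof. by elim: k g => //= k IH g; rewrite !IH; ring. Qed.

Lemma bexp_cst p k (c : R) : bexp p k (fun=> c) = c.
Proof. by elim: k => //= k ->; ring. Qed.

Lemma le_bexp p k g h : 0 <= p <= 1 -> (forall b, g b <= h b) ->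
  bexp p k g <= bexp p k h.
Proof.
move=> /andP[p0 p1]; elim: k g h => //= k IH g h gh.
by apply: lerD; rewrite ler_wpM2l ?subr_ge0//; apply: IH.
Qed.

Lemma bexp_last p k g :
  bexp p k.+1 g = p * bexp p k (fun b => g b.+1) + (1 - p) * bexp p k g.
Proof. by []. Qed.

Lemma bexp_eq0 p k : bexp p k (fun b => (b == 0%N)%:R) = (1 - p) ^+ k.
Proof.
elim: k => //= k ->; rewrite exprS (@eq_bexp _ _ _ (fun=> 0)) ?bexp_cst//.
by rewrite mulr0 add0r.
Qed.

(** Size-biasing: each of the [k + 1] trials succeeds with probability [p], and
given its success the number of the others is binomial with [k] trials. *)
Lemma bexp_size_bias p k g :
  bexp p k.+1 (fun b => b%:R * g b) = k.+1%:R * p * bexp p k (fun b => g b.+1).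
Proof.
elim: k g => [|k IH] g; first by rewrite /=; ring.
rewrite bexp_last IH [in RHS]bexp_last.
rewrite (@eq_bexp _ _ (fun b => b.+1%:R * g b.+1)
  (fun b => b%:R * g b.+1 + g b.+1)); last by move=> b; rewrite -natr1; ring.
rewrite bexpD IH [bexp p k.+1 (fun b => g b.+1)]bexp_last.
by rewrite -(natr1 k.+1); ring.
Qed.

Section inverse_moments.
Variables (p : R) (p01 : 0 < p <= 1).

Let p0 : 0 < p. Proof. by case/andP: p01. Qed.
Let p1 : p <= 1. Proof. by case/andP: p01. Qed.
Let pb : 0 <= p <= 1. Proof. by rewrite ltW. Qed.

Let np_gt0 k : 0 < k.+1%:R * p. Proof. by rewrite mulr_gt0 ?ltr0n. Qed.

Let inv_ge0 k : 0 <= (k.+1%:R * p)^-1. Proof. by rewrite invr_ge0 ltW. Qed.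

(** Size-biasing turns [1 / (b + 1)] into the indicator of [b > 0]. *)
Lemma bexp_inv_ge k :
  (1 - (1 - p) ^+ k.+1) / (k.+1%:R * p) <= bexp p k (fun b => b.+1%:R^-1).
Proof.
rewrite ler_pdivrMr// mulrC -(bexp_size_bias p k (fun b => b%:R^-1)) -bexp_eq0.
rewrite -{1}(bexp_cst p k.+1 1) -[X in _ - X]mul1r -mulNr -bexpZ -bexpD.
apply: le_bexp => // -[|b]; first by rewrite eqxx mulr1 mul0r subrr.
by rewrite divff ?pnatr_eq0//=; lra.
Qed.

(** Iterating this consequence of size-biasing bounds the inverse factorial
moments. *)
Lemma bexp_shift_le k g h : (forall b, 0 <= h b) ->
    (forall b, b.+1%:R * g b.+1 <= h b.+1) ->
  bexp p k (fun b => g b.+1) <= bexp p k.+1 h / (k.+1%:R * p).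
Proof.
move=> h0 gh; rewrite ler_pdivlMr// mulrC -bexp_size_bias.
by apply: le_bexp => // -[|b] //; rewrite mul0r.
Qed.

Lemma bexp_inv2_le k :
  bexp p k (fun b => (b.+1%:R * b.+2%:R)^-1) <=
  (k.+1%:R * p)^-1 * (k.+2%:R * p)^-1.
Proof.
apply: le_trans (bexp_shift_le (g := fun b => (b%:R * b.+1%:R)^-1)
  (h := fun b => b.+1%:R^-1) _ _ _) _ => [b|b|].
- by rewrite invr_ge0.
- by rewrite invfM mulrA divff ?mul1r// pnatr_eq0.
rewrite mulrC ler_wpM2l//.
apply: le_trans (bexp_shift_le (g := fun b => b%:R^-1) (h := fun=> 1) _ _ _) _.
- by move=> _; exact: ler01.
- by move=> b; rewrite divff ?pnatr_eq0.
by rewrite bexp_cst mul1r.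
Qed.

Lemma bexp_inv3_le k :
  bexp p k (fun b => (b.+1%:R * b.+2%:R * b.+3%:R)^-1) <=
  (k.+1%:R * p)^-1 * ((k.+2%:R * p)^-1 * (k.+3%:R * p)^-1).
Proof.
apply: le_trans (bexp_shift_le (g := fun b => (b%:R * b.+1%:R * b.+2%:R)^-1)
  (h := fun b => (b.+1%:R * b.+2%:R)^-1) _ _ _) _ => [b|b|].
- by rewrite invr_ge0 mulr_ge0.
- by rewrite -mulrA invfM mulrA divff ?mul1r// pnatr_eq0.
by rewrite mulrC ler_wpM2l// bexp_inv2_le.
Qed.

(** Compare [1 / (b + 1) ^ 2] with inverse factorial moments of order two and
three: it is at most [1 / ((b + 1) (b + 2)) + 3 / ((b + 1) (b + 2) (b + 3))]. *)
Lemma bexp_inv_sqr_le_shift k : bexp p k (fun b => (b.+1%:R ^- 2)) <=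
  (k.+1%:R * p)^-1 * (k.+2%:R * p)^-1 *
  (1 + 3 * (k.+3%:R * p)^-1).
Proof.
have -> : (k.+1%:R * p)^-1 * (k.+2%:R * p)^-1 * (1 + 3 * (k.+3%:R * p)^-1) =
    (k.+1%:R * p)^-1 * (k.+2%:R * p)^-1 +
    3 * ((k.+1%:R * p)^-1 * ((k.+2%:R * p)^-1 * (k.+3%:R * p)^-1)) :> R by ring.
apply: (le_trans _ (lerD (bexp_inv2_le k)
  (ler_wpM2l (ler0n _ 3) (bexp_inv3_le k)))).
rewrite -bexpZ -bexpD; apply: le_bexp => // b.
rewrite -(natr1 b.+2) -(natr1 b.+1); set x : R := b.+1%:R.
have x1 : 1 <= x by rewrite ler1n.
rewrite -subr_ge0 (_ : _ - _ = 2 * (x - 1) / (x ^+ 2 * (x + 1) * (x + 1 + 1))).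
  by rewrite divr_ge0// ?mulr_ge0//; try exact: sqr_ge0; lra.
by field; rewrite !gt_eqF//; lra.
Qed.

Lemma expr_le_inv k : (1 - p) ^+ k.+1 <= (k.+1%:R * p)^-1.
Proof.
suff h j : (1 - p) ^+ j * (1 + j%:R * p) <= 1.
  rewrite -[leRHS]mul1r ler_pdivlMr// (le_trans _ (h k.+1))// ler_wpM2l//.
    by rewrite exprn_ge0// subr_ge0.
  by rewrite lerDr.
elim: j => [|j IH]; first by rewrite expr0 mul0r addr0 mulr1.
apply: le_trans IH; rewrite exprSr -mulrA ler_wpM2l ?exprn_ge0 ?subr_ge0//.
rewrite -subr_ge0 -natr1 (_ : _ - _ = (j%:R + 1) * p ^+ 2); last by ring.
by rewrite mulr_ge0 ?sqr_ge0// addr_ge0.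
Qed.

Lemma bexp_inv_sqr_le k : bexp p k (fun b => b.+1%:R ^- 2) <=
  (k.+1%:R * p) ^- 2 * (1 + 3 * (k.+1%:R * p)^-1).
Proof.
apply: le_trans (bexp_inv_sqr_le_shift k) _.
have mono j : (k.+1 <= j.+1)%N -> (j.+1%:R * p)^-1 <= (k.+1%:R * p)^-1.
  by move=> kj; rewrite lef_pV2 ?posrE// ler_wpM2r ?(ltW p0)// ler_nat.
rewrite -exprVn expr2 -!mulrA ler_wpM2l//.
apply: ler_pM => //; first by rewrite addr_ge0// mulr_ge0.
- exact: mono.
- by rewrite lerD2l ler_wpM2l// mono// (leq_trans (leqnSn _)).
Qed.

Lemma bexp_inv_sqr_le_rate k : bexp p k (fun b => b.+1%:R ^- 2) <=
  4 / p ^+ 3 / k.+1%:R ^+ 2.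
Proof.
apply: le_trans (bexp_inv_sqr_le k) _.
set n : R := k.+1%:R; have n1 : 1 <= n by rewrite ler1n.
rewrite -subr_ge0.
rewrite (_ : _ - _ = ((n - 1) * 3 + n * (1 - p)) / (n ^+ 3 * p ^+ 3)).
  by rewrite divr_ge0 ?addr_ge0 ?mulr_ge0 ?exprn_ge0 ?subr_ge0 ?(ltW p0)//; lra.
by field; rewrite !gt_eqF//; lra.
Qed.

(** The relative fluctuation of the inverse of a binomial variable is of order
[1 / sqrt k]: the leading terms [1], [- 2] and [1] of the expanded square
cancel. *)
Lemma bexp_fluctuation k :
  bexp p k (fun b => (p * b.+1%:R^-1 - k.+1%:R^-1) ^+ 2) <=
  5 / p / k.+1%:R ^+ 3.
Proof.
set n : R := k.+1%:R; have n1 : 1 <= n by rewrite ler1n.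
have n0 : 0 < n by lra.
rewrite (@eq_bexp _ _ _ (fun b => p ^+ 2 * b.+1%:R ^- 2 +
  ((- (2 * p / n)) * b.+1%:R^-1 + n ^- 2))); last first.
  by move=> b; rewrite -!exprVn; ring.
rewrite !bexpD !bexpZ bexp_cst.
have h1 : p ^+ 2 * bexp p k (fun b => b.+1%:R ^- 2) <=
    p ^+ 2 * ((n * p) ^- 2 * (1 + 3 * (n * p)^-1)).
  by rewrite ler_wpM2l ?sqr_ge0// bexp_inv_sqr_le.
have h2 : - (2 * p / n) * bexp p k (fun b => b.+1%:R^-1) <=
    - (2 * p / n) * ((1 - (n * p)^-1) / (n * p)).
  rewrite !mulNr lerN2 ler_wpM2l ?divr_ge0 ?mulr_ge0 ?(ltW p0) ?(ltW n0)//.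
  apply: le_trans (bexp_inv_ge k); rewrite ler_wpM2r ?inv_ge0// lerD2l lerN2.
  exact: expr_le_inv.
apply: le_trans (lerD h1 (lerD h2 (lexx _))) _.
rewrite le_eqVlt; apply/orP; left; apply/eqP.
by field; rewrite !gt_eqF.
Qed.

End inverse_moments.
End binomial_moments.

(** If each of the events [A k] is independent, with probability [p], of the
number of earlier events that occurred, this number is binomial. *)
Lemma Ex_binomial d (T : measurableType d) (R : realType) (P : probability T R)
    (p : R) (A : nat -> set T) (B : nat -> T -> nat) :
    (forall w, B 0%N w = 0%N) ->
    (forall k w, B k.+1 w = (B k w + (w \in A k))%N) ->
    (forall k (g : nat -> R), L1 P (fun w => g (B k w))) ->
    (forall k (g : nat -> R), L1 P (fun w => \1_(A k) w * g (B k w))) ->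
    (forall k (g : nat -> R), Ex P (fun w => \1_(A k) w * g (B k w)) =
                              p * Ex P (fun w => g (B k w))) ->
  forall k (g : nat -> R), Ex P (fun w => g (B k w)) = bexp p k g.
Proof.
move=> B0 BS iB iAB AB; elim=> [|k IH] g.
  by under [X in Ex _ X]funext do rewrite B0; rewrite Ex_cst.
rewrite /= -!IH.
rewrite (_ : (fun w => g (B k.+1 w)) = fun w =>
  \1_(A k) w * g (B k w).+1 + (g (B k w) - \1_(A k) w * g (B k w))).
  rewrite ExD; [|exact: (iAB k (fun b => g b.+1))|exact: L1B].
  rewrite ExB// (AB k (fun b => g b.+1)) AB; ring.
apply/funext => w; rewrite BS indicE; case: (w \in A k).
  by rewrite addn1 !mul1r subrr addr0.
by rewrite addn0 !mul0r subr0 add0r.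
Qed.

(** * Decay rates from recursions *)

Section rates.
Context {R : realType}.
Implicit Types (s t x : R).

(** Bernoulli's inequality for an exponent below [1], as a case of Young's
inequality. *)
Lemma powR_bernoulli s x : 0 < s < 1 -> 0 <= x -> (1 + x) `^ s <= 1 + s * x.
Proof.
move=> /andP[s0 s1] x0; have x1 : 0 <= 1 + x by rewrite addr_ge0.
have := @conjugate_powR R ((1 + x) `^ s) 1 s^-1 (1 - s)^-1 (powR_ge0 _ _) ler01.
rewrite !invr_gt0 subr_gt0 !invrK => /(_ s0 s1) h.
apply: le_trans (_ : (1 + x) * s + (1 - s) <= _); last by lra.
rewrite -[leLHS]mulr1; apply: le_trans (h _) _; first by lra.
by rewrite -powRrM divff ?gt_eqF// powRr1// powR1 mul1r.
Qed.

(** The tail comparison of [1 / x ^ (1 + t)] with the increments of [1 / x ^ t],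
from [expR y >= 1 + y] and [ln y >= 1 - 1 / y]; it makes the series telescope. *)
Lemma pseries_step t (k : nat) : 0 < t ->
  t * k.+2%:R `^ (- 1 - t) <= k.+1%:R `^ (- t) - k.+2%:R `^ (- t).
Proof.
move=> t0; have k1 : 0 < k.+1%:R :> R by rewrite ltr0n.
have k2 : 0 < k.+2%:R :> R by rewrite ltr0n.
have q0 : 0 < k.+2%:R / k.+1%:R :> R by rewrite divr_gt0.
have key : 1 + t / k.+2%:R <= (k.+2%:R / k.+1%:R) `^ t.
  rewrite [leRHS]/powR gt_eqF// (le_trans _ (expR_ge1Dx _))// lerD2l ler_wpM2l ?(ltW t0)//.
  have := @le_ln1Dx R (k.+1%:R / k.+2%:R - 1).
  rewrite ltrBrDl addrN divr_gt0// => /(_ isT).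
  rewrite addrC subrK -[X in ln X]invrK invf_div lnV ?posrE// => h.
  rewrite -lerN2 (le_trans h)//.
  rewrite le_eqVlt; apply/orP; left; apply/eqP.
  by move/lt0r_neq0 : k2; rewrite -[k.+2%:R]natr1 => ?; field.
have -> : k.+2%:R `^ (- 1 - t) = k.+2%:R^-1 * k.+2%:R `^ (- t) :> R.
  by rewrite powRD ?powR_inv1 ?(ltW k2)//; apply/implyP; rewrite (gt_eqF k2).
have -> : k.+1%:R `^ (- t) = k.+2%:R `^ (- t) * (k.+2%:R / k.+1%:R) `^ t.
  rewrite !powRN.
  have <- : (k.+2%:R / k.+1%:R) `^ t * k.+1%:R `^ t = k.+2%:R `^ t :> R.
    by rewrite -powRM ?(ltW q0) ?(ltW k1)// divfK// (gt_eqF k1).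
  by field; rewrite !gt_eqF// powR_gt0.
have p0 := powR_gt0 (- t) k2.
rewrite -subr_ge0 (_ : _ - _ = k.+2%:R `^ (- t) *
  ((k.+2%:R / k.+1%:R) `^ t - (1 + t / k.+2%:R))); last by ring.
by rewrite mulr_ge0 ?(ltW p0)// subr_ge0 key.
Qed.

Lemma pseries_bounded t : 0 < t ->
  exists S, forall K, \sum_(k < K) k.+1%:R `^ (- 1 - t) <= S :> R.
Proof.
move=> t0; exists (1 + t^-1) => -[|K].
  by rewrite big_ord0 addr_ge0// invr_ge0 ltW.
rewrite big_ord_recl/= powR1 lerD2l.
suff : \sum_(i < K) t * (bump 0 i).+1%:R `^ (- 1 - t) <= 1 - K.+1%:R `^ (- t).
  rewrite -mulr_sumr -ler_pdivlMl// => /le_trans; apply.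
  by rewrite ler_piMr ?invr_ge0 ?(ltW t0)// gerBl powR_ge0.
elim: K => [|K IH]; first by rewrite big_ord0 powR1 subrr.
rewrite big_ord_recr/= /bump/= add1n.
have := pseries_step K t0; lra.
Qed.

(** Multiplying by [k `^ s] turns the drift [- s / k] into a contraction of
ratio at most [1], up to perturbations of order [k `^ (s - 3 / 2)], which are
summable because [s < 1 / 2]. *)
Lemma recursion_rate (e : nat -> R) s C : 0 < s < 1 / 2 -> 0 <= C ->
  (forall k, 0 <= e k) ->
  (forall k : nat, e k.+1 <= (1 - s / k.+1%:R + C * k.+1%:R `^ (- (3 / 2))) * e k
     + C * k.+1%:R `^ (- (3 / 2))) ->
  exists K, forall k, e k.+1 <= K * k.+1%:R `^ (- s).
Proof.
move=> /andP[s0 s12] C0 e0 rec; have s1 : s < 1 by lra.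
have [S SP] : exists S, forall K, \sum_(k < K) k.+1%:R `^ (- 1 - (1 / 2 - s)) <= S :> R.
  by apply: pseries_bounded; lra.
pose a k : R := 2 * (C + 1) * k.+1%:R `^ (- 1 - (1 / 2 - s)).
pose u k : R := e k.+1 * k.+1%:R `^ s.
have step k : 1 + u k.+1 <= expR (a k) * (1 + u k).
  have m0 : 0 < k.+1%:R :> R by rewrite ltr0n.
  have m1 : 1 <= k.+1%:R :> R by rewrite ler1n.
  set m : R := k.+1%:R in m0 m1 *; have nE : k.+2%:R = m + 1 :> R by rewrite natr1.
  pose b := m `^ (- (3 / 2)); have b0 : 0 <= b by exact: powR_ge0.
  have bn : (m + 1) `^ (- (3 / 2)) <= b.
    rewrite /b !powRN lef_pV2 ?posrE ?powR_gt0//; last by lra.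
    by apply: ge0_ler_powR; rewrite ?nnegrE; lra.
  have ee := e0 k.+1; have := rec k.+1; rewrite nE => rk.
  have smn : s / m - s / (m + 1) <= b.
    rewrite (_ : _ - _ = s / (m * (m + 1))); last by field; lra.
    apply: (@le_trans _ _ (m ^+ 2)^-1).
      rewrite ler_pdivrMr ?mulr_gt0//; last by lra.
      rewrite mulrC ler_pdivlMr ?exprn_gt0// expr2; nra.
    rewrite /b powRN lef_pV2 ?posrE ?powR_gt0 ?exprn_gt0//.
    by rewrite -powR_mulrn ?(ltW m0)//; apply: ler_powR => //; lra.
  have bd : e k.+2 <= (1 - s / m) * e k.+1 + (C + 1) * b * (e k.+1 + 1).
    apply: le_trans rk _; set b' := (m + 1) `^ _ in bn *.
    have h1 : C * b' <= C * b by rewrite ler_wpM2l.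
    set q := s / m in smn *; set q' := s / (m + 1) in smn *.
    have := ler_wpM2r ee h1; have := ler_wpM2r ee smn; nra.
  have ms1 : 1 <= m `^ s by rewrite -(powRr0 m) ler_powR// ltW.
  have ns : (m + 1) `^ s <= m `^ s * (1 + s / m).
    have -> : m + 1 = m * (1 + m^-1) by rewrite mulrDr mulr1 divff ?gt_eqF.
    rewrite powRM ?(ltW m0) ?addr_ge0 ?invr_ge0 ?(ltW m0)//.
    by rewrite ler_wpM2l ?powR_ge0// powR_bernoulli ?s0// invr_ge0 ltW.
  have aE : a k = 2 * (C + 1) * b * m `^ s.
    rewrite /a /b -[RHS]mulrA -powRD; last by apply/implyP; rewrite (gt_eqF m0).
    by congr (_ * _ `^ _); lra.
  have sm0 : 0 <= s / m by rewrite divr_ge0 ?ltW.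
  have sm1 : s / m <= 1 by rewrite ler_pdivrMr//; lra.
  rewrite /u nE -/m; set y := e k.+1 in ee bd *; set p := m `^ s in ms1 ns aE *.
  set q := s / m in ns bd sm0 sm1.
  have cb0 : 0 <= (C + 1) * b by rewrite mulr_ge0//; lra.
  have h1 : e k.+2 * (m + 1) `^ s <=
      ((1 - q) * y + (C + 1) * b * (y + 1)) * (p * (1 + q)).
    apply: ler_pM => //; first exact: powR_ge0.
  have h2 : e k.+2 * (m + 1) `^ s <= p * y + 2 * ((C + 1) * b) * p * (y + 1).
    apply: le_trans h1 _; set cb := (C + 1) * b in cb0 *.
    rewrite [leLHS](_ : _ = p * y * (1 - q ^+ 2) + cb * p * (y + 1) * (1 + q)); last by ring.
    have : p * y * (1 - q ^+ 2) <= p * y by rewrite ler_piMr ?mulr_ge0//; nra.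
    have : cb * p * (y + 1) * (1 + q) <= cb * p * (y + 1) * 2.
      by rewrite ler_wpM2l ?mulr_ge0//; lra.
    lra.
  apply: le_trans (_ : (1 + a k) * (1 + y * p) <= _); last first.
    by rewrite ler_wpM2r ?expR_ge1Dx// addr_ge0 ?mulr_ge0//; lra.
  rewrite aE; set cb := (C + 1) * b in cb0 h2 *.
  have : cb * p * y <= cb * p * (y * p) by rewrite ler_wpM2l ?mulr_ge0 ?ler_peMr//; lra.
  rewrite (_ : 2 * (C + 1) * b = 2 * cb); last by rewrite /cb; ring.
  lra.
have bound k : 1 + u k <= expR (\sum_(j < k) a j) * (1 + u 0%N).
  elim: k => [|k IH]; first by rewrite big_ord0 expR0 mul1r.
  apply: le_trans (step k) _; rewrite big_ord_recr/= expRD [_ * expR (a k)]mulrC -mulrA.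
  by rewrite ler_wpM2l// expR_ge0.
exists (expR (2 * (C + 1) * S) * (1 + u 0%N)) => k.
have u00 : 0 <= u 0%N by rewrite mulr_ge0 ?powR_ge0.
rewrite powRN ler_pdivlMr ?powR_gt0// -/(u k).
apply: le_trans (_ : 1 + u k <= _); first by rewrite lerDr.
apply: le_trans (bound k) _; rewrite ler_wpM2r ?addr_ge0// ler_expR -mulr_sumr.
by rewrite ler_wpM2l ?mulr_ge0//; lra.
Qed.

Lemma powRN_cvg0 s : 0 < s -> (fun k : nat => k%:R `^ (- s)) @ \oo --> (0 : R).
Proof.
move=> s0; apply/cvgrPdist_lt => e e0; near=> k.
rewrite sub0r normrN ger0_norm ?powR_ge0// powRN.
have ke : e `^ (- s^-1) < k%:R by near: k; exact: nbhs_infty_gtr.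
have k0 : 0 < k%:R :> R by apply: le_lt_trans ke; exact: powR_ge0.
rewrite invf_plt ?posrE ?powR_gt0//.
have -> : e^-1 = (e `^ (- s^-1)) `^ s.
  by rewrite -powRrM mulNr mulVf ?gt_eqF// powR_inv1 ?ltW.
by apply: gt0_ltr_powR; rewrite ?nnegrE ?powR_ge0// ltW.
Unshelve. all: by end_near. Qed.

End rates.

(** * Almost sure convergence from summable variation *)

(** The total variation of the sequence has a finite mean, so almost every
trajectory converges; by Fatou's lemma its limit has mean [0]. *)
Lemma ae_cvg_of_summable_variation d (T : measurableType d) (R : realType)
    (P : probability T R) (Y : nat -> T -> R) (S : R) :
    (forall k w, 0 <= Y k w) -> (forall k, L1 P (Y k)) ->
    (forall K, \sum_(k < K) Ex P (fun w => `|Y k.+1 w - Y k w|) <= S) ->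
    (fun k => Ex P (Y k)) @ \oo --> (0 : R) ->
  {ae P, forall w, (fun k => Y k w) @ \oo --> (0 : R)}.
Proof.
move=> Y0 intY varY cvE.
have mY k : measurable_fun setT (Y k) by exact: L1_meas.
pose V k w : R := `|Y k.+1 w - Y k w|.
have intV k : L1 P (V k) by exact/L1_norm/L1B.
have mV k : measurable_fun setT (EFin \o V k) by exact/measurable_EFinP/L1_meas.
pose W w := (\sum_(0 <= k <oo) (V k w)%:E)%E.
have V0 k w : 0 <= V k w by exact: normr_ge0.
have W0 w : (0 <= W w)%E by apply: nneseries_ge0 => k _ _; rewrite lee_fin.
have mW : measurable_fun setT W.
  by apply: ge0_emeasurable_sum => [k w _ _|k _]; [rewrite lee_fin|exact: mV].
have intW : P.-integrable setT W.
  apply/integrableP; split => //.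
  under eq_integral do rewrite gee0_abs//.
  rewrite integral_nneseries//; last by move=> k w _; rewrite lee_fin.
  apply: (@le_lt_trans _ _ S%:E); last by rewrite ltry.
  apply: lime_le.
    apply: is_cvg_nneseries => k _ _; apply: integral_ge0 => w _.
    by rewrite lee_fin.
  apply: nearW => K.
  rewrite (eq_bigr (fun k => (Ex P (V k))%:E)) => [|k _]; last by rewrite Ex_EFin.
  by rewrite sumEFin lee_fin big_mkord.
have cvY w : W w \is a fin_num -> cvgn (fun k => Y k w).
  move=> Wfin; have : cvgn (series (telescope (fun k => Y k w))).
    apply: normed_cvg; apply: nnseries_is_cvg => [k|]; first exact: normr_ge0.
    by rewrite -[X in (X < _)%E]/(W w) -ge0_fin_numE.
  move=> /cvg_ex[l cl]; apply/cvg_ex; exists (Y 0%N w + l).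
  rewrite (_ : (fun k => Y k w) =
      fun k => Y 0%N w + series (telescope (fun k => Y k w)) k).
    by apply: cvgD cl; exact: cvg_cst.
  by apply/funext => k; rewrite -eq_sum_telescope.
pose L w := limn_einf (fun k => (Y k w)%:E).
have L0 w : (0 <= L w)%E.
  rewrite /L limn_einf_lim; apply: lime_ge; first exact: is_cvg_einfs.
  by apply: nearW => k; apply: le_ereal_inf_tmp => _ [l _ <-]; rewrite lee_fin.
have mL : measurable_fun setT L.
  rewrite (_ : L = fun w => (- limn_esup (fun k => (- Y k w)%:E))%E).
    apply: measurableT_comp => //.
    apply: (@measurable_fun_limn_esup _ _ _ setT (fun k w => (- Y k w)%:E)) => k.
    by apply/measurable_EFinP; exact: measurableT_comp.
  by apply/funext => w; rewrite -limn_einfN; congr limn_einf; apply/funext => k /=; rewrite opprK.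
have intL : (\int[P]_w L w = 0)%E.
  apply/eqP; rewrite eq_le; apply/andP; split; last exact: integral_ge0.
  apply: le_trans (fatou P measurableT (f := fun k w => (Y k w)%:E) _ _) _.
  - by move=> k; exact/measurable_EFinP.
  - by move=> k w _; rewrite lee_fin.
  have cvI : (fun k => \int[P]_w (Y k w)%:E)%E @ \oo --> 0%:E.
    rewrite (_ : (fun k => _) = fun k => (Ex P (Y k))%:E).
      by apply: cvg_EFin => //; exact: nearW.
    by apply/funext => k; rewrite Ex_EFin.
  by rewrite (cvg_limn_einf_sup cvI).1.
have aeL : ae_eq P setT L (cst 0%E).
  apply/(ae_eq_integral_abs P measurableT mL); rewrite -[RHS]intL.
  by apply: eq_integral => w _; rewrite gee0_abs.
apply: filterS2 (integrable_ae measurableT intW) aeL => w /(_ I) Wfin /(_ I)/= Lw.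
have /cvg_ex[l cl] := cvY w Wfin.
have cl' : (fun k => (Y k w)%:E) @ \oo --> l%:E by apply: cvg_EFin => //; exact: nearW.
by move: Lw; rewrite /L (cvg_limn_einf_sup cl').1 => -[<-].
Qed.

(** * Measurability with respect to a history *)

Section adapted.
Context d {T : measurableType d} {R : realType}.
Implicit Types (G H : set (set T)) (f g : T -> R).

Definition adapted G f :=
  measurable_fun setT (f : g_sigma_algebraType G -> R).

Lemma adapted_preimage G f B : adapted G f -> measurable B ->
  <<s G >> (f @^-1` B).
Proof. by move=> mf mB; have := mf measurableT B mB; rewrite setTI. Qed.

Lemma adapted_sub G H f : <<s G >> `<=` <<s H >> -> adapted G f -> adapted H f.
Proof. by move=> GH mf _ B mB; apply: GH; exact: mf. Qed.

Lemma adapted_measurable G f : <<s G >> `<=` measurable -> adapted G f ->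
  measurable_fun setT f.
Proof. by move=> GH mf _ B mB; apply: GH; exact: mf. Qed.

Lemma adapted_cst G (c : R) : adapted G (fun=> c).
Proof. exact: measurable_cst. Qed.

Lemma adaptedD G f g : adapted G f -> adapted G g ->
  adapted G (fun w => f w + g w).
Proof. exact: measurable_funD. Qed.

Lemma adaptedB G f g : adapted G f -> adapted G g ->
  adapted G (fun w => f w - g w).
Proof. exact: measurable_funB. Qed.

Lemma adaptedM G f g : adapted G f -> adapted G g ->
  adapted G (fun w => f w * g w).
Proof. exact: measurable_funM. Qed.

Lemma adapted_indic G A : <<s G >> A -> adapted G (\1_A).
Proof. by move=> GA; apply: measurable_indic. Qed.

Lemma adapted_nat G (B : T -> nat) (g : nat -> R) :
  adapted G (fun w => (B w)%:R) -> adapted G (fun w => g (B w)).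
Proof.
move=> mB _ Y mY; rewrite setTI.
rewrite (_ : _ @^-1` Y = \bigcup_(b in g @^-1` Y)
    ((fun w => (B w)%:R : R) @^-1` [set b%:R])); last first.
  apply/seteqP; split => w /=; first by move=> Yw; exists (B w).
  by move=> [b Yb] /eqP; rewrite eqr_nat => /eqP ->.
by apply: bigcup_measurable => b _; exact: adapted_preimage.
Qed.

Lemma adapted_continuous_row G k (u : T -> 'rV[R]_k) (h : 'rV[R]_k -> R) :
  (forall j, adapted G (fun w => u w 0 j)) -> continuous h ->
  adapted G (fun w => h (u w)).
Proof.
move=> mu ch; have mu' := @measurable_row R _ (g_sigma_algebraType G) k u mu.
have mh : measurable_fun setT (h : borel 'rV[R]_k -> R).
  exact: borel_measurable_continuous.
exact: (measurableT_comp mh mu').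
Qed.

End adapted.

(** * Convexity of the solution set *)

Section convexity.
Context d {T : measurableType d} {R : realType} {P : probability T R}.
Context {N m : nat} {n : 'I_N -> nat} (G : game P n m).
Variables (O : forall i : 'I_N, set 'rV[R]_(n i)) (hA : assumptionA G O).

Lemma strat_convex i u v (t : R) : strat G i u -> strat G i v -> 0 <= t <= 1 ->
  strat G i (t *: u + (1 - t) *: v).
Proof.
move=> Su Sv /andP[t0 t1].
have := A1_convex hA (@Itv01 _ t t0 t1) (mem_set Su) (mem_set Sv).
by rewrite inE /conv.
Qed.

(** Quadratic growth at a convex combination [z] of two solutions [y1], [y2]:
the corresponding combination of [z - y1] and [z - y2] vanishes, which forces
the distance of [z] to the solution set to vanish. *)
Lemma solVI_convex (alpha : R) : 0 < alpha -> quadratic_growth G alpha ->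
  forall (y1 y2 : profile R n) (t : R), solVI G y1 -> solVI G y2 -> 0 <= t <= 1 ->
  solVI G (fun i => t *: y1 i + (1 - t) *: y2 i).
Proof.
move=> a0 hQG y1 y2 t s1 s2 t01; set z : profile R n := fun i => _.
have Xz : stratX G z by move=> i; apply: strat_convex => //; [case: s1|case: s2].
have clS := A3_closed hA; have S0 := A3_nonempty hA.
have h1 := hQG z y1 Xz s1; have h2 := hQG z y2 Xz s2.
have d0 : alpha * dist z (solVI G) ^+ 2 <= 0.
  have -> : 0 = t * pdot (psub z y1) (Fmap G z) + (1 - t) * pdot (psub z y2) (Fmap G z).
    rewrite !pdotE !pack_psub -!dotZl -dotDl (_ : _ + _ = 0).
      by rewrite dot0l.
    have -> : pack z = t *: pack y1 + (1 - t) *: pack y2.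
      by apply/rowP => j; rewrite !mxE.
    by apply/rowP => j; rewrite !mxE; ring.
  case/andP: t01 => t0 t1; have t1' : 0 <= 1 - t by rewrite subr_ge0.
  have := ler_wpM2l t0 h1; have := ler_wpM2l t1' h2; lra.
have := d0; rewrite pmulr_rle0// dist_pproj// pnormE enorm_sqr => /dot_eq0.
rewrite pack_psub => /eqP; rewrite subr_eq0 => /eqP zE.
by rewrite -(packK z) zE packK; exact: pproj_mem.
Qed.

End convexity.

(** * The iterates and their histories *)

Section iterates.
Context (R : realType) (d : measure_display) (T : measurableType d)
    (P : probability T R) (N m : nat) (n : 'I_N -> nat) (G : game P n m)
    (O : forall i : 'I_N, set 'rV[R]_(n i)) (p : 'I_N -> R)
    (sel : nat -> T -> 'I_N) (zeta : nat -> {RV P >-> borel 'rV[R]_m})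
    (x : nat -> T -> profile R n).
Hypotheses (hA : assumptionA G O) (hS : sagr G sel zeta x p).

(** The histories [F_k] and [F_(k + 1/2)] are generated by these families, which
are named so that the histories can serve as measurable types. *)
Definition generators k : set (set T) :=
  preimage_set_system setT (x 0%N : T -> borel (profile R n)) measurable
  `|` \bigcup_(t in `I_k)
        (preimage_set_system setT (sel t) setT `|`
         preimage_set_system setT
           (sampled_grad G sel zeta x t : T -> borel (profile R n)) measurable).

Definition generators_half k : set (set T) :=
  history G sel zeta x k `|` preimage_set_system setT (sel k) setT.

Lemma historyE k : history G sel zeta x k = <<s generators k >>.
Proof. by []. Qed.

Lemma generatorsS k : <<s generators k >> `<=` <<s generators k.+1 >>.
Proof.
apply: sub_smallest2r => //; apply: setUS; apply: bigcup_subset => t /=.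
by move=> tk; exact: (ltn_trans tk).
Qed.

Lemma generators_le_half k : <<s generators k >> `<=` <<s generators_half k >>.
Proof. by move=> A hAk; apply: sub_sigma_algebra; left. Qed.

Definition selected k i := sel k @^-1` [set i].

Definition prior_updates i k w : nat := (\sum_(t < k) (sel t w == i))%N.

Lemma count0 i w : prior_updates i 0 w = 0%N.
Proof. by rewrite /prior_updates big_ord0. Qed.

Lemma countS i k w : prior_updates i k.+1 w = (prior_updates i k w + (w \in selected k i))%N.
Proof.
rewrite /prior_updates big_ord_recr/=; congr (_ + nat_of_bool _)%N.
by apply/eqP/idP => [h|/set_mem//]; rewrite inE.
Qed.

Lemma event_half k i : <<s generators_half k >> (selected k i).
Proof. by apply: sub_sigma_algebra; right; exists [set i]; rewrite ?setTI. Qed.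

Lemma event_history t k i : (t < k)%N -> <<s generators k >> (selected t i).
Proof.
move=> tk; apply: sub_sigma_algebra; right; exists t => //; left.
by exists [set i]; rewrite ?setTI.
Qed.

Lemma adapted_count k i (g : nat -> R) :
  adapted (generators k) (fun w => g (prior_updates i k w)).
Proof.
apply: adapted_nat; rewrite (_ : (fun w => _) =
    fun w => \sum_(t < k) (\1_(selected t i) w : R)); last first.
  apply/funext => w; rewrite /prior_updates natr_sum; apply: eq_bigr => t _.
  rewrite indicE; congr (nat_of_bool _)%:R.
  by apply/eqP/idP => [h|/set_mem//]; rewrite inE.
apply: (@measurable_sum _ (g_sigma_algebraType (generators k))) => t.
exact: (adapted_indic (@event_history _ _ _ (ltn_ord t))).
Qed.

Lemma mem_event k i w : (w \in selected k i) = (sel k w == i).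
Proof. by apply/idP/eqP => [/set_mem//|h]; rewrite inE. Qed.

Lemma stepsizeE k w :
  stepsize sel k (sel k w) w = (prior_updates (sel k w) k w).+1%:R^-1 :> R.
Proof.
rewrite /stepsize /nupdates big_ord_recr/= eqxx addn1 /= div1r.
by [].
Qed.

(** On its own turn player [i] uses the step [1 / (prior_updates + 1)], a quantity
known before the selection. *)
Lemma iterateS k i w : x k.+1 w i =
  if sel k w == i then
    eproj (strat G i) (x k w i -
      (prior_updates i k w).+1%:R^-1 *: sampled_grad G sel zeta x k w i)
  else x k w i.
Proof.
rewrite (sagr_step hS) /upd stepsizeE /sampled_grad.
case: eqVneq => [<-|neq]; first by rewrite dfwithin.
by rewrite dfwithout.
Qed.

Lemma strat_nonempty i : strat G i !=set0.
Proof. by have [x0 X0 _] := sagr_init hS; exists (x0 i). Qed.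

Lemma iterate_feasible k w : stratX G (x k w).
Proof.
elim: k => [|k IH] i; first by have [x0 X0 ->] := sagr_init hS.
rewrite iterateS; case: eqP => // _.
by have [] := eprojP (strat_nonempty i) (@A1_closed _ _ _ _ _ _ _ _ _ hA i)
  (x k w i - (prior_updates i k w).+1%:R^-1 *: sampled_grad G sel zeta x k w i).
Qed.

(** The current strategies and the current sample stay in the set on which the
sampled gradient is trace-measurable. *)
Lemma sampled_grad_measurable k i (j : 'I_(n i)) :
  <<s generators k >> `<=` measurable ->
  (forall i j, adapted (generators k) (fun w => x k w i 0 j)) ->
  measurable_fun setT (fun w => sampled_grad G sel zeta x k w i 0 j).
Proof.
move=> gm mx.
pose f w := cost_grad G i (x k w) (zeta k w) 0 j.
have mf : measurable_fun setT f.
  move=> _ B mB; have [C mC DC] := A2_cost_meas hA j mB.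
  rewrite setTI (_ : f @^-1` B = (fun w => (x k w, zeta k w)) @^-1` C).
    rewrite -[X in measurable X]setTI.
    have : measurable_fun setT (fun w => (x k w, zeta k w) :
        (borel (profile R n) * borel 'rV[R]_m)%type).
      apply: measurable_fun_pair => //; apply: measurable_profile => i' j'.
      exact: (adapted_measurable gm).
    by apply.
  have h w : (stratX G `*` range (xi G)) (x k w, zeta k w).
    by split => /=; [exact: iterate_feasible | exact: (sagr_zeta_range hS)].
  apply/seteqP; split => w fw.
    by have [] : ((stratX G `*` range (xi G)) `&` C) (x k w, zeta k w) by rewrite -DC.
  have [] : ((stratX G `*` range (xi G)) `&`
     (fun u => cost_grad G i u.1 u.2 0 j) @^-1` B) (x k w, zeta k w) by rewrite DC.
  by [].
rewrite (_ : (fun w => _) = fun w => \1_(selected k i) w * f w).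
  by apply: measurable_funM => //; apply: measurable_indic; exact: (sagr_sel_meas hS).
apply/funext => w; rewrite /sampled_grad indicE mem_event.
by case: eqP => _; [rewrite [RHS]mul1r | rewrite [RHS]mul0r mxE].
Qed.

(** The two claims are proved together: the histories are made of events because
the iterates, hence the sampled gradients, are measurable; and the next iterate
is a continuous function of the current one, of the selection and of the sampled
gradient, all of which the next history contains. *)
Lemma iterate_adapted k : <<s generators k >> `<=` measurable /\
  forall i j, adapted (generators k) (fun w => x k w i 0 j).
Proof.
elim: k => [|k [gm mx]].
  have [x0 _ x0E] := sagr_init hS.
  have mx0 : forall i j, adapted (generators 0) (fun w => x 0%N w i 0 j).
    by move=> i j; rewrite (_ : (fun w => _) = cst (x0 i 0 j));
      [exact: adapted_cst | apply/funext => w; rewrite x0E].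
  split => //; apply: smallest_sub; first exact: sigma_algebra_measurable.
  move=> A [[B mB <-]|[t]]; last by rewrite /= ltn0.
  rewrite setTI; have [Bx|Bx] := pselect (B x0).
    rewrite (_ : _ @^-1` _ = setT)//; apply/seteqP; split => // w _.
    by rewrite /preimage/= x0E.
  rewrite (_ : _ @^-1` _ = set0)//; apply/seteqP; split => // w.
  by rewrite /preimage/= x0E.
have msg i j := @sampled_grad_measurable k i j gm mx.
have gm' : <<s generators k.+1 >> `<=` measurable.
  apply: smallest_sub; first exact: sigma_algebra_measurable.
  move=> A [hA0|[t]].
    by apply: gm; apply: sub_sigma_algebra; left.
  rewrite /= ltnS leq_eqVlt => /predU1P[->|tk].
    move=> [[B _ <-]|[B mB <-]].
      rewrite setTI (_ : _ @^-1` B = \bigcup_(i in B) selected k i).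
        apply: fin_bigcup_measurable => // i _; exact: (sagr_sel_meas hS).
      apply/seteqP; split => w; first by move=> Bw; exists (sel k w).
      by move=> [i Bi]; rewrite /selected/= => ->.
    have := measurable_profile msg; apply => //.
  by move=> hAt; apply: gm; apply: sub_sigma_algebra; right; exists t.
split => // i j.
have mx' i' j' : adapted (generators k.+1) (fun w => x k w i' 0 j').
  exact: adapted_sub (@generatorsS k) _.
have msg' l : adapted (generators k.+1)
    (fun w => sampled_grad G sel zeta x k w i 0 l).
  apply: (@measurable_profile_coord _ _ (g_sigma_algebraType (generators k.+1))).
  move=> _ B mB; apply: sub_sigma_algebra; right; exists k => //=.
  by right; exists B.
have mev : adapted (generators k.+1) (\1_(selected k i) : T -> R).
  exact: (adapted_indic (event_history i (ltnSn k))).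
have mcount : adapted (generators k.+1) (fun w => (prior_updates i k w).+1%:R^-1 : R).
  apply: adapted_sub (@generatorsS k) _.
  exact: (@adapted_count k i (fun b => b.+1%:R^-1)).
pose u w := x k w i - (prior_updates i k w).+1%:R^-1 *: sampled_grad G sel zeta x k w i.
have mh : adapted (generators k.+1) (fun w => eproj (strat G i) (u w) 0 j).
  apply: (adapted_continuous_row (h := fun v => eproj (strat G i) v 0 j)).
    move=> l; rewrite (_ : (fun w => _) = fun w => x k w i 0 l -
      (prior_updates i k w).+1%:R^-1 * sampled_grad G sel zeta x k w i 0 l).
      by apply: adaptedB => //; apply: adaptedM.
    by apply/funext => w; rewrite !mxE.
  apply: nonexpansive_coord_continuous => v w; apply: eproj_nonexpansive.
  - exact: strat_nonempty.
  - exact: (A1_closed hA).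
  - by move=> *; exact: (strat_convex hA).
rewrite (_ : (fun w => _) = fun w => \1_(selected k i) w * eproj (strat G i) (u w) 0 j +
  (1 - \1_(selected k i) w) * x k w i 0 j).
  by apply: adaptedD; apply: adaptedM => //; apply: adaptedB => //; exact: adapted_cst.
apply/funext => w; rewrite iterateS indicE mem_event; case: eqP => _.
  by rewrite /= subrr mul0r addr0 mul1r.
by rewrite /= subr0 mul0r mul1r add0r.
Qed.


(** * Selections, update counts and noise *)

Let gm k : <<s generators k >> `<=` measurable.
Proof. by have [] := iterate_adapted k. Qed.

Let event_measurable k i : measurable (selected k i).
Proof. exact: (sagr_sel_meas hS). Qed.

Let ghm k : <<s generators_half k >> `<=` measurable.
Proof.
apply: smallest_sub; first exact: sigma_algebra_measurable.
move=> A [hA0|[B _ <-]]; first exact: (@gm k).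
rewrite setTI (_ : _ @^-1` B = \bigcup_(i in B) selected k i).
  by apply: fin_bigcup_measurable.
apply/seteqP; split => w; first by move=> Bw; exists (sel k w).
by move=> [i Bi]; rewrite /selected/= => ->.
Qed.

Let p_ge0 i : 0 <= p i. Proof. exact/ltW/(sagr_p_gt0 hS). Qed.

Let p_le1 i : p i <= 1.
Proof.
rewrite -(sagr_p_sum hS) (bigD1 i)//= lerDl sumr_ge0// => j _; exact: p_ge0.
Qed.

Lemma indic_norm_le1 (A : set T) w : `|\1_A w : R| <= 1.
Proof. by rewrite indicE; case: (_ \in _); rewrite ?normr1 ?normr0. Qed.

Lemma L1_event f k i : L1 P f -> L1 P (fun w => \1_(selected k i) w * f w).
Proof.
move=> intf; rewrite (_ : (fun w => _) = fun w => f w * \1_(selected k i) w).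
  by apply: (@L1M_bounded _ _ _ _ 1) => // w; exact: indic_norm_le1.
by apply/funext => w; rewrite mulrC.
Qed.

(** A history-dependent quantity is independent of the current selection. *)
Lemma Ex_event k i f : adapted (generators k) f -> L1 P f ->
  Ex P (fun w => \1_(selected k i) w * f w) = p i * Ex P f.
Proof.
move=> mf intf; apply/eqP; rewrite -subr_eq0; apply/eqP.
have ie : L1 P (fun w => \1_(selected k i) w - p i).
  by apply: L1B; [exact: integrable_indic|exact: L1_cst].
rewrite -ExZ// -ExB//; [|exact: L1_event|exact: L1Z].
rewrite -[RHS](@Ex_orthogonal _ _ _ P (generators k) (fun w => \1_(selected k i) w - p i) f)//.
- by congr Ex; apply/funext => w; rewrite mulrBl.
- move=> A hAk; have mA := gm hAk.
  rewrite integralB_EFin//; last 2 first.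
    by apply: integrableS (integrable_indic P (event_measurable k i)).
    by apply: integrableS (L1_cst P (p i)).
  rewrite integral_indic// integral_cst//= setIC.
  rewrite -historyE in hAk; rewrite (sagr_sel_indep hS i hAk) (sagr_sel_law hS).
  have fA : P A \is a fin_num by exact: fin_num_measure.
  by rewrite muleC subee// fin_numM.
- rewrite (_ : (fun w => _) = fun w => \1_(selected k i) w * f w - p i * f w).
    by apply: L1B; [exact: L1_event|exact: L1Z].
  by apply/funext => w; rewrite mulrBl.
Qed.

Lemma count_le i k w : (prior_updates i k w <= k)%N.
Proof.
rewrite /prior_updates -[leqRHS](card_ord k) -sum1_card; apply: leq_sum => t _.
by case: (_ == _).
Qed.

Lemma count_bounded i k (g : nat -> R) w :
  `|g (prior_updates i k w)| <= \sum_(b < k.+1) `|g b|.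
Proof.
have kw : (prior_updates i k w < k.+1)%N by rewrite ltnS count_le.
by rewrite (bigD1 (Ordinal kw))//= lerDl sumr_ge0.
Qed.

Lemma count_measurable i k (g : nat -> R) :
  measurable_fun setT (fun w => g (prior_updates i k w)).
Proof. exact: (adapted_measurable (@gm k) (@adapted_count k i g)). Qed.

Lemma L1_count i k (g : nat -> R) : L1 P (fun w => g (prior_updates i k w)).
Proof. by apply: L1_bounded (@count_measurable i k g) _ => w; exact: count_bounded. Qed.

(** Successive selections of player [i] are independent of the past, so the number
of its earlier updates is binomial. *)
Lemma Ex_count i k (g : nat -> R) :
  Ex P (fun w => g (prior_updates i k w)) = bexp (p i) k g.
Proof.
apply: (@Ex_binomial _ _ _ P (p i) (selected ^~ i) (prior_updates i)) => {k g}.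
- exact: count0.
- exact: countS.
- exact: L1_count.
- by move=> k g; apply/L1_event/L1_count.
- by move=> k g; apply: Ex_event; [exact: adapted_count|exact: L1_count].
Qed.

Variables (Mw MF : 'I_N -> R) (hC : assumptionC G sel zeta x Mw MF).

Notation noise_ k w := (noise G sel zeta x k w).
Notation grad_ k w := (sampled_grad G sel zeta x k w).

Lemma L1_noise k i j : L1 P (fun w => noise_ k w i 0 j).
Proof. by have [] := C1 hC k j. Qed.

Lemma L1_noise_sqr k : L1 P (fun w => pnorm (noise_ k w) ^+ 2).
Proof. by have [g []] := C2 hC k. Qed.

(** The noise is orthogonal to whatever is known once the player is selected. *)
Lemma Ex_noise k i j h : adapted (generators_half k) h ->
  L1 P (fun w => noise_ k w i 0 j * h w) ->
  Ex P (fun w => noise_ k w i 0 j * h w) = 0.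
Proof.
move=> mh inth; apply: (@Ex_orthogonal _ _ _ P (generators_half k)) => //.
  exact: L1_noise.
by move=> A hAk; have [_ _ _ ->] := C1 hC k j; rewrite ?integral0.
Qed.

Lemma adapted_event k i (g : nat -> R) :
  adapted (generators_half k) (fun w => \1_(selected k i) w * g (prior_updates i k w)).
Proof.
apply: adaptedM; first exact: (adapted_indic (@event_half k i)).
by apply: adapted_sub (@generators_le_half k) _; exact: adapted_count.
Qed.

Lemma Ex_event_count k i (g : nat -> R) :
  Ex P (fun w => \1_(selected k i) w * g (prior_updates i k w)) = p i * bexp (p i) k g.
Proof.
by rewrite Ex_event; [rewrite Ex_count|exact: adapted_count|exact: L1_count].
Qed.

Lemma event_count_bounded k i (g : nat -> R) w :
  `|\1_(selected k i) w * g (prior_updates i k w)| <= \sum_(b < k.+1) `|g b|.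
Proof.
by rewrite normrM -[leRHS]mul1r ler_pM// ?indic_norm_le1 ?count_bounded.
Qed.

Lemma event_count_measurable k i (g : nat -> R) :
  measurable_fun setT (fun w => \1_(selected k i) w * g (prior_updates i k w)).
Proof. exact: (adapted_measurable (@ghm k) (@adapted_event k i g)). Qed.

Lemma L1_noise_sqr_event k i (g : nat -> R) :
  L1 P (fun w => pnorm (noise_ k w) ^+ 2 * (\1_(selected k i) w * g (prior_updates i k w))).
Proof.
apply: L1M_bounded (L1_noise_sqr k) (@event_count_measurable k i g) _ => w.
exact: event_count_bounded.
Qed.

(** The bound on the conditional second moment of the noise carries over to
weights that are known once the player has been selected. *)
Lemma Ex_noise_sqr_le k i (g : nat -> R) : (forall b, 0 <= g b) ->
  Ex P (fun w => pnorm (noise_ k w) ^+ 2 * (\1_(selected k i) w * g (prior_updates i k w)))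
  <= Mw i ^+ 2 * (p i * bexp (p i) k g).
Proof.
move=> g0; have [v [intn intv mv condE] vle] := C2 hC k.
pose h w : R := \1_(selected k i) w * g (prior_updates i k w).
have hb := @event_count_bounded k i g.
have mh := @event_count_measurable k i g.
have h0 w : 0 <= h w by rewrite mulr_ge0// indicE.
have ivh : L1 P (fun w => v w * h w) by exact: L1M_bounded intv mh hb.
have inh := @L1_noise_sqr_event k i g.
have -> : Ex P (fun w => pnorm (noise_ k w) ^+ 2 * h w) = Ex P (fun w => v w * h w).
  apply/eqP; rewrite -subr_eq0 -ExB//; apply/eqP.
  rewrite -[RHS](@Ex_orthogonal _ _ _ P (generators_half k)
    (fun w => pnorm (noise_ k w) ^+ 2 - v w) h)//.
  - by congr Ex; apply/funext => w; rewrite mulrBl.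
  - exact: L1B.
  - move=> A hAk; rewrite integralB_EFin//.
    + rewrite condE// subee//; apply: integrable_fin_num; first exact: ghm hAk.
      by apply: integrableS intv => //; exact: ghm hAk.
    + exact: ghm hAk.
    + by apply: integrableS intn => //; exact: ghm hAk.
    + by apply: integrableS intv => //; exact: ghm hAk.
  - exact: adapted_event.
  - by apply: L1M_bounded mh hb; exact: L1B.
rewrite -Ex_event_count -ExZ; last by apply: L1_event; exact: L1_count.
apply: le_Ex_ae => //; first by apply/L1Z/L1_event/L1_count.
apply: filterS vle => w vw; rewrite /h indicE mem_event.
case: eqP => [<-|_]; last by rewrite /= !mul0r !mulr0.
by rewrite /= !mul1r ler_wpM2r.
Qed.

(** * One step of the scheme *)

(** The gradient of an expected cost is the expectation of a sampled gradient, to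
which Tonelli's theorem applies. *)
Lemma Fmap_adapted k i j : adapted (generators k) (fun w => Fmap G (x k w) i 0 j).
Proof.
have [g mg gE] := @trace_measurable_Ex R _ _ _ T P (borel (profile R n))
  (borel 'rV[R]_m) (stratX G) (xi G) (fun u => cost_grad G i u.1 u.2 0 j)
  (measurable_funPT (xi G)) (A2_cost_meas hA j).
rewrite (_ : (fun w => _) = fun w => g (x k w)).
  have mx : measurable_fun setT
      (x k : g_sigma_algebraType (generators k) -> borel (profile R n)).
    by apply: measurable_profile; case: (iterate_adapted k).
  exact: (measurableT_comp mg mx).
apply/funext => w; have [intF FE] := A2_exchange hA j (@iterate_feasible k w).
rewrite gE//; last exact: iterate_feasible.
by apply: EFin_inj; rewrite FE unlock -Ex_EFin.
Qed.

Variables (alpha : R) (alpha_gt0 : 0 < alpha) (hQG : quadratic_growth G alpha).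

Let clS : closed (solVI G). Proof. exact: (A3_closed hA). Qed.
Let S0 : solVI G !=set0. Proof. exact: (A3_nonempty hA). Qed.

Definition gap k i w : 'rV[R]_(n i) := x k w i - pproj (solVI G) (x k w) i.

Definition sqdist k w : R := dist (x k w) (solVI G) ^+ 2.

Lemma sqdistE k w : sqdist k w = \sum_i dot (gap k i w) (gap k i w).
Proof. by rewrite /sqdist dist_pproj// pnorm_sqr. Qed.

Lemma sqdist_ge0 k w : 0 <= sqdist k w.
Proof. exact: sqr_ge0. Qed.

(** The solution set is closed and convex, so the nearest solution is a
nonexpansive, hence continuous, function of the iterate. *)
Lemma gap_adapted k i j : adapted (generators k) (fun w => gap k i w 0 j).
Proof.
have mx i' j' : adapted (generators k) (fun w => x k w i' 0 j').
  by case: (iterate_adapted k).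
rewrite (_ : (fun w => _) =
    fun w => x k w i 0 j - pproj (solVI G) (x k w) i 0 j); last first.
  by apply/funext => w; rewrite !mxE.
apply: adaptedB => //.
pose h v := pproj (solVI G) (unpack v) i 0 j.
rewrite (_ : (fun w => _) = fun w => h (pack (x k w))); last first.
  by apply/funext => w; rewrite /h packK.
apply: adapted_continuous_row => [l|].
  rewrite (_ : (fun w => _) = fun w => x k w (tagnat.sig1 l) 0 (tagnat.sig2 l)) //.
  by apply/funext => w; rewrite mxE.
rewrite (_ : h = fun v => pack (pproj (solVI G) (unpack v)) 0 (tagnat.Rank i j)).
  apply: (@nonexpansive_coord_continuous _ _ _
    (fun v => pack (pproj (solVI G) (unpack v)))) => u v.
  rewrite -{3 4}(unpackK u) -{3 4}(unpackK v); apply: pproj_nonexpansive => //.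
  exact: (solVI_convex hA alpha_gt0 hQG).
by apply/funext => v; rewrite /h unpackK mxE.
Qed.

Lemma sqdist_adapted k : adapted (generators k) (sqdist k).
Proof.
rewrite (_ : sqdist k = fun w => \sum_i \sum_j gap k i w 0 j * gap k i w 0 j).
  apply: (@measurable_sum _ (g_sigma_algebraType (generators k))) => i.
  apply: (@measurable_sum _ (g_sigma_algebraType (generators k))) => j.
  by apply: adaptedM; exact: gap_adapted.
by apply/funext => w; rewrite sqdistE.
Qed.

Let MF_ge0 i : 0 <= MF i. Proof. exact/ltW/(C3_gt0 hC). Qed.

Notation weight k i w := (\1_(selected k i) w * (prior_updates i k w).+1%:R^-1 : R).
Notation weight2 k i w := (\1_(selected k i) w * (prior_updates i k w).+1%:R ^- 2 : R).

Lemma sampled_gradE k i w : sel k w = i ->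
  grad_ k w i = Fmap G (x k w) i + noise_ k w i.
Proof.
move=> <-; rewrite /sampled_grad /noise eqxx /Fmap addrC subrK //.
Qed.

Lemma dot_grad_le k i w : sel k w = i ->
  dot (grad_ k w i) (grad_ k w i) <= 2 * MF i ^+ 2 + 2 * pnorm (noise_ k w) ^+ 2.
Proof.
move=> ki; rewrite sampled_gradE//; apply: le_trans (dot_add_sqr_le _ _) _.
apply: lerD; rewrite ler_wpM2l//.
  rewrite -enorm_sqr ler_sqr ?nnegrE ?enorm_ge0//.
  exact: (C3 hC i (@iterate_feasible k w)).
rewrite pnorm_sqr /pdot (bigD1 i)//= lerDl sumr_ge0// => j _; exact: dot_ge0.
Qed.

(** Only the selected block moves, and it moves by a projected step. *)
Lemma step_sqr_le k w (y : profile R n) : stratX G y ->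
  pdot (psub (x k.+1 w) y) (psub (x k.+1 w) y) <=
  pdot (psub (x k w) y) (psub (x k w) y) +
  \sum_i (weight2 k i w * dot (grad_ k w i) (grad_ k w i) -
          2 * (weight k i w * dot (grad_ k w i) (x k w i - y i))).
Proof.
move=> Xy; rewrite /pdot -big_split; apply: ler_sum => i _.
rewrite /= /psub iterateS indicE mem_event; case: eqP => ki; last first.
  by rewrite /= !mul0r mulr0 subr0 addr0.
rewrite /= !mul1r; apply: le_trans (eproj_fejer _ _ _ _ (Xy i)) _.
- exact: strat_nonempty.
- exact: (A1_closed hA).
- by move=> *; exact: (strat_convex hA).
rewrite addrAC dot_sub_scale (dotC (grad_ k w i) (x k w i - y i)) exprVn le_eqVlt.
by apply/orP; left; apply/eqP; ring.
Qed.

(** Bounds the squared displacement of the iterate, through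
[|F + w| ^ 2 <= 2 |F| ^ 2 + 2 |w| ^ 2]. *)
Definition move_bound k w : R :=
  \sum_i (2 * MF i ^+ 2 * weight2 k i w +
          2 * (pnorm (noise_ k w) ^+ 2 * weight2 k i w)).

Lemma weight2_grad_le k w :
  \sum_i weight2 k i w * dot (grad_ k w i) (grad_ k w i) <= move_bound k w.
Proof.
apply: ler_sum => i _; rewrite indicE mem_event; case: eqP => [ki|_]; last first.
  by rewrite /= !mul0r !mulr0 addr0.
have := dot_grad_le ki; have : 0 <= (prior_updates i k w).+1%:R ^- 2 :> R.
  by rewrite invr_ge0 exprn_ge0.
rewrite /= !mul1r; set c := _ ^- 2; move=> c0 /(ler_wpM2l c0) /le_trans; apply.
by rewrite le_eqVlt; apply/orP; left; apply/eqP; ring.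
Qed.

Lemma displacement_le k w :
  pdot (psub (x k.+1 w) (x k w)) (psub (x k.+1 w) (x k w)) <= move_bound k w.
Proof.
apply: le_trans (step_sqr_le k w (@iterate_feasible k w)) _.
apply: le_trans (weight2_grad_le k w).
rewrite [X in X + _ <= _](_ : _ = 0).
  rewrite add0r; apply: ler_sum => i _.
  by rewrite subrr dotC dot0l !mulr0 subr0.
rewrite /pdot big1// => i _.
by rewrite /psub subrr dot0l.
Qed.

(** Compare the next iterate with the nearest solution of the current one. *)
Lemma sqdistS_le k w : sqdist k.+1 w <= sqdist k w
  - 2 * \sum_i weight k i w * dot (Fmap G (x k w) i) (gap k i w)
  - 2 * \sum_i \sum_j noise_ k w i 0 j * (weight k i w * gap k i w 0 j)
  + move_bound k w.
Proof.
have Sy := pproj_mem clS S0 (x k w).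
apply: le_trans (dist_sqr_le clS S0 (x k.+1 w) Sy) _.
apply: le_trans (step_sqr_le k w Sy.1) _.
rewrite big_split/= sumrN -mulr_sumr.
have := weight2_grad_le k w.
rewrite -[X in X + _ <= _]/(\sum_i dot (gap k i w) (gap k i w)) -sqdistE.
rewrite [X in _ <= _ - _ - 2 * X + _](_ : _ = \sum_i weight k i w * dot (noise_ k w i) (gap k i w)); last first.
  by apply: eq_bigr => i _; rewrite /dot mulr_sumr; apply: eq_bigr => j _; ring.
rewrite -[\sum_i _ * dot (grad_ k w i) (x k w i - _)]/(\sum_i weight k i w * dot (grad_ k w i) (gap k i w)).
have -> : \sum_i weight k i w * dot (grad_ k w i) (gap k i w) =
    \sum_i weight k i w * dot (Fmap G (x k w) i) (gap k i w) +
    \sum_i weight k i w * dot (noise_ k w i) (gap k i w).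
  rewrite -big_split; apply: eq_bigr => i _ /=; rewrite indicE mem_event.
  case: eqP => [ki|_]; last by rewrite /= !mul0r addr0.
  by rewrite sampled_gradE// dotDl mulrDr.
lra.
Qed.

(** * The recursion for the mean squared distance *)

(** The inner product that quadratic growth bounds below, for one block. *)
Definition drift k i w : R := dot (Fmap G (x k w) i) (gap k i w).

Lemma drift_adapted k i : adapted (generators k) (drift k i).
Proof.
apply: (@measurable_sum _ (g_sigma_algebraType (generators k))) => j.
by apply: adaptedM; [exact: Fmap_adapted|exact: gap_adapted].
Qed.

Lemma enorm_gap_sqr_le k i w : enorm (gap k i w) ^+ 2 <= sqdist k w.
Proof.
rewrite enorm_sqr sqdistE (bigD1 i)//= lerDl sumr_ge0// => j _.
exact: dot_ge0.
Qed.

Lemma drift_norm_le k i w : `|drift k i w| <= MF i * enorm (gap k i w).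
Proof. by apply: norm_dot_le => //; exact: (C3 hC i (@iterate_feasible k w)). Qed.

Lemma L1_drift k i : L1 P (sqdist k) -> L1 P (drift k i).
Proof.
move=> intD; apply: L1_le (L1Z (MF i) (L1D (L1_cst P 1) intD)) _.
  exact: (adapted_measurable (@gm k) (@drift_adapted k i)).
move=> w; apply: le_trans (drift_norm_le k i w) _; rewrite ler_wpM2l//.
have := enorm_gap_sqr_le k i w; set t := enorm _; nra.
Qed.

Lemma inv_count_le1 k i w : `|(prior_updates i k w).+1%:R^-1 : R| <= 1.
Proof. by rewrite ger0_norm ?invr_ge0// invf_le1 ?ler1n// ltr0n. Qed.

Lemma weight_norm_le1 k i w : `|weight k i w| <= 1.
Proof.
by rewrite normrM -[leRHS]mulr1 ler_pM// ?indic_norm_le1 ?inv_count_le1.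
Qed.

Lemma L1_noise_gap k i j : L1 P (sqdist k) ->
  L1 P (fun w => noise_ k w i 0 j * (weight k i w * gap k i w 0 j)).
Proof.
move=> intD; apply: L1_le (L1D (L1_noise_sqr k) intD) _.
  apply: measurable_funM; first exact/L1_meas/L1_noise.
  apply: measurable_funM.
    exact: (@event_count_measurable k i (fun b => b.+1%:R^-1)).
  exact: (adapted_measurable (@gm k) (@gap_adapted k i j)).
move=> w; have h1 : (gap k i w 0 j) ^+ 2 <= sqdist k w.
  apply: le_trans (enorm_gap_sqr_le k i w); rewrite enorm_sqr.
  exact: sqr_coord_le_dot.
have h2 : (noise_ k w i 0 j) ^+ 2 <= pnorm (noise_ k w) ^+ 2.
  rewrite pnorm_sqr /pdot (bigD1 i)//=.
  apply: le_trans (sqr_coord_le_dot (noise_ k w i) j) _.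
  by rewrite lerDl sumr_ge0// => l _; exact: dot_ge0.
rewrite normrM [X in _ * X]normrM.
apply: (@le_trans _ _ (`|noise_ k w i 0 j| * `|gap k i w 0 j|)).
  by rewrite ler_wpM2l// ler_piMl// weight_norm_le1.
move: h1 h2; rewrite -[X in X <= sqdist k w]real_normK ?num_real//.
rewrite -[X in X <= pnorm _ ^+ 2]real_normK ?num_real//.
set a := `|_|; set b := `|gap k i w 0 j|; nra.
Qed.

Lemma L1_move_bound k : L1 P (move_bound k).
Proof.
apply: L1_sum => i _; apply: L1D; apply: L1Z.
  by apply: L1_event; exact: (@L1_count i k (fun b => b.+1%:R ^- 2)).
exact: (@L1_noise_sqr_event k i (fun b => b.+1%:R ^- 2)).
Qed.

Let L1_noise_sum k : L1 P (sqdist k) -> L1 P (fun w =>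
  \sum_i \sum_j noise_ k w i 0 j * (weight k i w * gap k i w 0 j)).
Proof.
by move=> intD; apply: L1_sum => i _; apply: L1_sum => j _; exact: L1_noise_gap.
Qed.

Let L1_inv_drift k i : L1 P (sqdist k) ->
  L1 P (fun w => (prior_updates i k w).+1%:R^-1 * drift k i w).
Proof.
move=> intD; rewrite (_ : (fun w => _) =
    fun w => drift k i w * (prior_updates i k w).+1%:R^-1); last first.
  by apply/funext => w; rewrite mulrC.
apply: (@L1M_bounded _ _ _ _ 1); first exact: L1_drift.
  exact: (@count_measurable i k (fun b => b.+1%:R^-1)).
exact: inv_count_le1.
Qed.

Let L1_drift_sum k : L1 P (sqdist k) ->
  L1 P (fun w => \sum_i weight k i w * drift k i w).
Proof.
move=> intD; apply: L1_sum => i _.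
rewrite (_ : (fun w => _) =
    fun w => \1_(selected k i) w * ((prior_updates i k w).+1%:R^-1 * drift k i w)).
  by apply: L1_event; exact: L1_inv_drift.
by apply/funext => w; rewrite mulrA.
Qed.

(** By induction, as each distance is bounded by integrable functions of the
preceding iteration. *)
Lemma L1_sqdist k : L1 P (sqdist k).
Proof.
elim: k => [|k intD].
  have [x0 _ x0E] := sagr_init hS.
  rewrite (_ : sqdist 0 = fun=> dist x0 (solVI G) ^+ 2); first exact: L1_cst.
  by apply/funext => w; rewrite /sqdist x0E.
apply: L1_le (L1D (L1B (L1B intD (L1Z 2 (L1_drift_sum intD)))
  (L1Z 2 (L1_noise_sum intD))) (L1_move_bound k)) _.
  exact: (adapted_measurable (@gm k.+1) (@sqdist_adapted k.+1)).
by move=> w; rewrite ger0_norm ?sqdist_ge0// sqdistS_le.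
Qed.

Definition move_const : R :=
  \sum_i (2 * MF i ^+ 2 + 2 * Mw i ^+ 2) * (p i * (4 / p i ^+ 3)).

Let p01 i : 0 < p i <= 1.
Proof. by rewrite (sagr_p_gt0 hS) p_le1. Qed.

Let moment_ge0 i : 0 <= 2 * MF i ^+ 2 + 2 * Mw i ^+ 2.
Proof. by rewrite addr_ge0// mulr_ge0// sqr_ge0. Qed.

Lemma move_const_ge0 : 0 <= move_const.
Proof.
apply: sumr_ge0 => i _; rewrite mulr_ge0 ?moment_ge0// mulr_ge0//.
by rewrite divr_ge0// exprn_ge0.
Qed.

Lemma Ex_move_bound_le k : Ex P (move_bound k) <= move_const / k.+1%:R ^+ 2.
Proof.
have intw i := @L1_count i k (fun b => b.+1%:R ^- 2).
have intn i := @L1_noise_sqr_event k i (fun b => b.+1%:R ^- 2).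
rewrite /move_bound Ex_sum; last first.
  by move=> i; apply: L1D; apply: L1Z; [apply: L1_event; exact: intw|exact: intn].
rewrite /move_const mulr_suml; apply: ler_sum => i _.
rewrite ExD; [|by apply: L1Z; apply: L1_event; exact: intw|by apply: L1Z; exact: intn].
rewrite ExZ; last by apply: L1_event; exact: intw.
rewrite ExZ; last exact: intn.
rewrite (@Ex_event_count k i (fun b => b.+1%:R ^- 2)).
have g0 b : 0 <= b.+1%:R ^- 2 :> R by rewrite invr_ge0 exprn_ge0.
apply: le_trans (lerD (lexx _) (ler_wpM2l (ler0n _ 2) (@Ex_noise_sqr_le k i _ g0))) _.
rewrite (mulrA 2 (Mw i ^+ 2)) -mulrDl -mulrA ler_wpM2l ?moment_ge0//.
by rewrite -mulrA ler_wpM2l// bexp_inv_sqr_le_rate.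
Qed.

(** Taking means, the noise disappears and the selection indicator is replaced by
its probability. *)
Lemma Ex_sqdistS_le k : Ex P (sqdist k.+1) <= Ex P (sqdist k)
  - 2 * Ex P (fun w => \sum_i p i * ((prior_updates i k w).+1%:R^-1 * drift k i w))
  + move_const / k.+1%:R ^+ 2.
Proof.
have intD := L1_sqdist k.
have i1 := L1Z 2 (L1_drift_sum intD); have i2 := L1Z 2 (L1_noise_sum intD).
apply: le_trans (le_Ex (L1_sqdist k.+1)
  (L1D (L1B (L1B intD i1) i2) (L1_move_bound k)) (sqdistS_le k)) _.
rewrite ExD; [|exact: L1B (L1B intD i1) i2|exact: L1_move_bound].
rewrite ExB//; last exact: L1B.
rewrite ExB// ExZ; last exact: L1_drift_sum.
rewrite ExZ; last exact: L1_noise_sum.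
have -> : Ex P (fun w =>
    \sum_i \sum_j noise_ k w i 0 j * (weight k i w * gap k i w 0 j)) = 0.
  rewrite Ex_sum => [|i]; last by apply: L1_sum => j _; exact: L1_noise_gap.
  rewrite big1// => i _; rewrite Ex_sum => [|j]; last exact: L1_noise_gap.
  rewrite big1// => j _; apply: Ex_noise; last exact: L1_noise_gap.
  apply: adaptedM; first exact: (@adapted_event k i (fun b => b.+1%:R^-1)).
  by apply: adapted_sub (@generators_le_half k) _; exact: gap_adapted.
have -> : Ex P (fun w => \sum_i weight k i w * drift k i w) =
    Ex P (fun w => \sum_i p i * ((prior_updates i k w).+1%:R^-1 * drift k i w)).
  have wE i : (fun w => weight k i w * drift k i w) =
      fun w => \1_(selected k i) w * ((prior_updates i k w).+1%:R^-1 * drift k i w).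
    by apply/funext => w; rewrite mulrA.
  rewrite Ex_sum => [|i]; last by rewrite wE; apply: L1_event; exact: L1_inv_drift.
  rewrite Ex_sum => [|i]; last by apply: L1Z; exact: L1_inv_drift.
  apply: eq_bigr => i _; rewrite wE ExZ; last exact: L1_inv_drift.
  rewrite Ex_event//; last exact: L1_inv_drift.
  apply: adaptedM; last exact: drift_adapted.
  exact: (@adapted_count k i (fun b => b.+1%:R^-1)).
by rewrite mulr0 subr0 lerD2l Ex_move_bound_le.
Qed.

Definition rec_const : R := \sum_i MF i * (5 / p i + 1) + move_const.

Lemma rec_const_ge0 : 0 <= rec_const.
Proof.
rewrite addr_ge0 ?move_const_ge0// sumr_ge0// => i _.
by rewrite mulr_ge0// addr_ge0// divr_ge0.
Qed.

(** Replacing [p i / (prior_updates + 1)] by [1 / (k + 1)] costs the second sum,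
by the arithmetic-geometric inequality. The weights [a] and [b] will be of order
[k `^ (3 / 2)] and [k `^ (- (3 / 2))], which gives both parts of this sum the
same order. *)
Lemma drift_sum_ge k w (a b : R) : 0 < b -> a * b = 1 ->
  2 * \sum_i p i * ((prior_updates i k w).+1%:R^-1 * drift k i w) >=
  2 * alpha / k.+1%:R * sqdist k w -
  \sum_i MF i * (a * (p i * (prior_updates i k w).+1%:R^-1 - k.+1%:R^-1) ^+ 2 +
                 b * sqdist k w).
Proof.
move=> b0 ab.
have Sy := pproj_mem clS S0 (x k w).
have := hQG (@iterate_feasible k w) Sy.
have -> : pdot (psub (x k w) (pproj (solVI G) (x k w))) (Fmap G (x k w)) =
    \sum_i drift k i w by apply: eq_bigr => i _; rewrite dotC.
rewrite -/(sqdist k w) => qg.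
have n0 : 0 <= 2 / k.+1%:R :> R by rewrite divr_ge0.
have := ler_wpM2l n0 qg; rewrite lerBlDr => qg'.
apply: (@le_trans _ _ (2 / k.+1%:R * (\sum_i drift k i w))).
  by apply: le_trans qg'; rewrite le_eqVlt; apply/orP; left; apply/eqP; ring.
rewrite !mulr_sumr -big_split; apply: ler_sum => i _ /=.
set c := (prior_updates i k w).+1%:R^-1; set q := k.+1%:R^-1.
have h := drift_norm_le k i w; have h2 := enorm_gap_sqr_le k i w.
have e0 := enorm_ge0 (gap k i w); move: h h2 e0.
set dr := drift k i w; set D := sqdist k w; set v := enorm _ => h h2 e0.
rewrite -lerBlDl (_ : _ - _ = - (2 * (p i * c - q) * dr)); last by ring.
set dl := p i * c - q.
apply: (@le_trans _ _ (2 * `|dl| * (MF i * v))).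
  rewrite -!mulrA -mulrN ler_wpM2l// (le_trans (ler_norm _))// normrN normrM.
  by rewrite ler_wpM2l.
rewrite [leLHS](_ : _ = MF i * (2 * `|dl| * v)); last by ring.
rewrite ler_wpM2l//.
have a0 : 0 < a by rewrite -(pmulr_lgt0 _ b0) ab.
apply: (@le_trans _ _ (a * dl ^+ 2 + b * v ^+ 2)); last by rewrite lerD2l ler_wpM2l// ltW.
rewrite -(real_normK (num_real dl)) -subr_ge0.
rewrite (_ : _ - _ = a * (`|dl| - b * v) ^+ 2).
  by rewrite mulr_ge0 ?sqr_ge0// ltW.
rewrite [RHS](_ : _ =
  a * `|dl| ^+ 2 - 2 * (a * b) * `|dl| * v + (a * b) * b * v ^+ 2); last by ring.
by rewrite ab; ring.
Qed.

Lemma sqdist_recursion k : Ex P (sqdist k.+1) <=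
  (1 - 2 * alpha / k.+1%:R + rec_const * k.+1%:R `^ (- (3 / 2))) * Ex P (sqdist k) +
  rec_const * k.+1%:R `^ (- (3 / 2)).
Proof.
set r : R := k.+1%:R; set b := r `^ (- (3 / 2)).
have r1 : 1 <= r by rewrite ler1n.
have r0 : 0 < r by rewrite ltr0n.
pose a := r `^ (3 / 2).
have b0 : 0 < b by exact: powR_gt0.
have ab : a * b = 1 by rewrite /a /b powRN divff// gt_eqF// powR_gt0.
have am : a / r ^+ 3 = b.
  rewrite /a /b -powR_mulrn ?(ltW r0)// -powRN -powRD; last first.
    by apply/implyP; rewrite (gt_eqF r0).
  by congr (_ `^ _); lra.
have mb : (r ^+ 2)^-1 <= b.
  rewrite /b powRN lef_pV2 ?posrE ?powR_gt0 ?exprn_gt0//.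
  by rewrite -powR_mulrn ?(ltW r0)//; apply: ler_powR => //; lra.
have intD := L1_sqdist k.
have e0 : 0 <= Ex P (sqdist k) by apply: Ex_ge0 => w; exact: sqdist_ge0.
have intf i := @L1_count i k (fun c => (p i * c.+1%:R^-1 - r^-1) ^+ 2).
have intS : L1 P (fun w => \sum_i
    MF i * (a * (p i * (prior_updates i k w).+1%:R^-1 - r^-1) ^+ 2 + b * sqdist k w)).
  by apply: L1_sum => i _; apply/L1Z/L1D; apply: L1Z; [exact: intf|].
have intdr : L1 P (fun w => \sum_i p i * ((prior_updates i k w).+1%:R^-1 * drift k i w)).
  by apply: L1_sum => i _; apply: L1Z; exact: L1_inv_drift.
have key : 2 * alpha / r * Ex P (sqdist k) - \sum_i MF i * (5 / p i * b + b * Ex P (sqdist k))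
    <= 2 * Ex P (fun w => \sum_i p i * ((prior_updates i k w).+1%:R^-1 * drift k i w)).
  rewrite -[leRHS]ExZ//.
  apply: le_trans (le_Ex (L1B (L1Z (2 * alpha / r) intD) intS) (L1Z 2 intdr)
    (fun w => @drift_sum_ge k w a b b0 ab)).
  rewrite ExB//; last exact: L1Z.
  rewrite ExZ// lerD2l lerN2 Ex_sum; last first.
    by move=> i; apply/L1Z/L1D; apply: L1Z; [exact: intf|].
  apply: ler_sum => i _; rewrite ExZ; last by apply/L1D; apply: L1Z; [exact: intf|].
  rewrite ler_wpM2l// ExD; [|by apply: L1Z; exact: intf|exact: L1Z].
  rewrite (ExZ a (intf i)) (ExZ b intD) lerD2r (@Ex_count i k (fun c => (p i * c.+1%:R^-1 - r^-1) ^+ 2)).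
  rewrite -am mulrCA ler_wpM2l ?powR_ge0//.
  exact: (bexp_fluctuation (p01 i) k).
apply: le_trans (Ex_sqdistS_le k) _; rewrite -/r.
have mc : move_const / r ^+ 2 <= move_const * b by rewrite ler_wpM2l ?move_const_ge0.
have sE : \sum_i MF i * (5 / p i * b + b * Ex P (sqdist k)) <=
    (\sum_i MF i * (5 / p i + 1)) * (b + b * Ex P (sqdist k)).
  rewrite mulr_suml; apply: ler_sum => i _; rewrite -[leRHS]mulrA ler_wpM2l//.
  have p5 : 0 <= 5 / p i by rewrite divr_ge0.
  have be : 0 <= b * Ex P (sqdist k) by rewrite mulr_ge0// ltW.
  have := mulr_ge0 p5 be; set y := b * Ex _ _ in be *; set q := 5 / p i in p5 *.
  nra.
have mbe : 0 <= move_const * b * Ex P (sqdist k).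
  by rewrite !mulr_ge0 ?move_const_ge0// ltW.
move: key mc sE mbe; rewrite /rec_const; set s1 := \sum_i MF i * _.
set e := Ex P (sqdist k); set s2 := \sum_i _; set q := 2 * alpha / r.
set t := move_const / _.
lra.
Qed.

(** * Rate and summable variation *)

(** Squared distances to the solution set differ, up to a proportion [c], by at
most a multiple of the squared displacement; both directions come from one
weighted triangle inequality. *)
Lemma sqdist_variation k w (c : R) : 0 < c ->
  `|sqdist k.+1 w - sqdist k w| <=
  c * (sqdist k w + sqdist k.+1 w) + (1 + c^-1) * move_bound k w.
Proof.
move=> c0.
have young (u v : 'rV[R]_(\sum_i n i)) :
    dot (u + v) (u + v) <= (1 + c) * dot u u + (1 + c^-1) * dot v v.
  have := dot_ge0 (c *: u - v).
  rewrite !(dotBl, dotBr, dotZl, dotZr, dotDl, dotDr) (dotC v u) => h.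
  have ic0 : 0 < c^-1 by rewrite invr_gt0.
  have := mulr_ge0 (ltW ic0) h.
  rewrite [X in 0 <= X -> _](_ : _ = c * dot u u - 2 * dot u v + c^-1 * dot v v).
    lra.
  by field; rewrite gt_eqF.
have cmp y z : dist y (solVI G) ^+ 2 <= (1 + c) * dist z (solVI G) ^+ 2 +
    (1 + c^-1) * pdot (psub y z) (psub y z).
  have Sz := pproj_mem clS S0 z.
  apply: le_trans (dist_sqr_le clS S0 y Sz) _.
  rewrite (dist_pproj clS S0 z) pnorm_sqr !pdotE !pack_psub.
  rewrite [X in dot X _](_ : _ = (pack z - pack (pproj (solVI G) z)) + (pack y - pack z)).
    rewrite [X in dot _ X](_ : _ = (pack z - pack (pproj (solVI G) z)) + (pack y - pack z)).
      exact: young.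
    by rewrite [RHS]addrC addrA subrK.
  by rewrite [RHS]addrC addrA subrK.
have ic0 : 0 <= 1 + c^-1 by rewrite addr_ge0// invr_ge0 ltW.
have h1 := cmp (x k.+1 w) (x k w); have h2 := cmp (x k w) (x k.+1 w).
have := ler_wpM2l ic0 (displacement_le k w); move: h1 h2.
rewrite [pdot (psub (x k w) (x k.+1 w)) _](_ : _ =
  pdot (psub (x k.+1 w) (x k w)) (psub (x k.+1 w) (x k w))); last first.
  by rewrite !pdotE !pack_psub dot_sub_sym.
rewrite -!/(sqdist _ _); have := sqdist_ge0 k w; have := sqdist_ge0 k.+1 w.
set D := sqdist k w; set D' := sqdist k.+1 w.
set Q := (1 + c^-1) * move_bound k w; set Q' := _ * pdot _ _ => D'0 D0 h1 h2 h3.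
have cD : 0 <= c * D by rewrite mulr_ge0// ltW.
have cD' : 0 <= c * D' by rewrite mulr_ge0// ltW.
by rewrite ler_norml; apply/andP; split; lra.
Qed.

Hypothesis alpha_small : 2 * alpha < 1 / 2.

Lemma sqdist_rate :
  exists K, forall k, Ex P (sqdist k.+1) <= K * k.+1%:R `^ (- (2 * alpha)).
Proof.
apply: (@recursion_rate _ (fun k => Ex P (sqdist k)) _ rec_const).
- by rewrite mulr_gt0.
- exact: rec_const_ge0.
- by move=> k; apply: Ex_ge0 => w; exact: sqdist_ge0.
- exact: sqdist_recursion.
Qed.

(** Weighting the cross term of [sqdist_variation] by [c := k `^ (alpha - 1)]
balances the mean of [sqdist], of order [k `^ (- 2 * alpha)], against that of
the squared displacement, of order [k `^ (- 2)]: both contributions are of the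
summable order [k `^ (- 1 - alpha)]. *)
Lemma sqdist_summable_variation : exists S, forall K,
  \sum_(k < K) Ex P (fun w => `|sqdist k.+2 w - sqdist k.+1 w|) <= S.
Proof.
have r2e : - 2 <= - 1 - alpha by move: alpha_small => h; lra.
have alg (a b X Y : R) : a * Y <= a * X ->
  2 * b * X + a * (Y + X) <= (2 * b + 2 * a) * X by lra.
have [K1 rate] := sqdist_rate.
have K0 : 0 <= K1.
  have := rate 0%N; rewrite powR1 mulr1; apply: le_trans.
  by apply: Ex_ge0 => w; exact: sqdist_ge0.
have [S SP] := @pseries_bounded R alpha alpha_gt0.
exists ((2 * K1 + 2 * move_const) * S) => K.
apply: (@le_trans _ _ (\sum_(k < K)
   (2 * K1 + 2 * move_const) * k.+1%:R `^ (- 1 - alpha))); last first.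
  rewrite -mulr_sumr ler_wpM2l// addr_ge0// mulr_ge0//; exact: move_const_ge0.
apply: ler_sum => k _.
set r : R := k.+1%:R; have r1 : 1 <= r by rewrite ler1n.
have r0 : 0 < r by rewrite ltr0n.
pose c := r `^ (alpha - 1).
have c0 : 0 < c by exact: powR_gt0.
have powD (y z : R) : r `^ (y + z) = r `^ y * r `^ z.
  by rewrite powRD//; apply/implyP; rewrite (gt_eqF r0).
have iD := L1_sqdist.
have iv : L1 P (fun w => c * (sqdist k.+1 w + sqdist k.+2 w)) by exact/L1Z/L1D.
have im : L1 P (fun w => (1 + c^-1) * move_bound k.+1 w).
  by apply: L1Z; exact: L1_move_bound.
apply: le_trans (le_Ex (L1_norm (L1B (iD k.+2) (iD k.+1))) (L1D iv im)
  (fun w => sqdist_variation k.+1 w c0)) _.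
rewrite ExD// (ExZ c (L1D (iD k.+1) (iD k.+2))) ExD//.
rewrite (ExZ (1 + c^-1) (L1_move_bound k.+1)).
have e1 : Ex P (sqdist k.+1) <= K1 * r `^ (- (2 * alpha)) by exact: rate.
have e2 : Ex P (sqdist k.+2) <= K1 * r `^ (- (2 * alpha)).
  apply: le_trans (rate k.+1) _; rewrite ler_wpM2l// !powRN.
  rewrite lef_pV2 ?posrE ?powR_gt0// ge0_ler_powR ?nnegrE ?mulr_ge0 ?(ltW alpha_gt0)//.
  by rewrite ler_nat.
have e3 : Ex P (move_bound k.+1) <= move_const * r `^ (- 2).
  apply: le_trans (Ex_move_bound_le k.+1) _; rewrite ler_wpM2l ?move_const_ge0//.
  rewrite powRN powR_mulrn ?(ltW r0)// lef_pV2 ?posrE ?exprn_gt0//.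
  by rewrite ler_sqr ?nnegrE ?(ltW r0)// ler_nat.
have cE : c * r `^ (- (2 * alpha)) = r `^ (- 1 - alpha).
  by rewrite /c -powD; congr (_ `^ _); ring.
have icE : c^-1 * r `^ (- 2) = r `^ (- 1 - alpha).
  by rewrite /c -powRN -powD; congr (_ `^ _); ring.
have r2 : r `^ (- 2) <= r `^ (- 1 - alpha) by exact: ler_powR.
have ic0 : 0 <= 1 + c^-1 by rewrite addr_ge0// invr_ge0 ltW.
apply: le_trans (lerD (ler_wpM2l (ltW c0) (lerD e1 e2)) (ler_wpM2l ic0 e3)) _.
rewrite [leLHS](_ : _ = 2 * K1 * (c * r `^ (- (2 * alpha))) +
  move_const * (r `^ (- 2) + c^-1 * r `^ (- 2))); last by ring.
by rewrite cE icE; apply/alg/ler_wpM2l/r2/move_const_ge0.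
Qed.

Lemma Ex_sqdist_cvg0 : (fun k => Ex P (sqdist k.+1)) @ \oo --> (0 : R).
Proof.
have [K1 rate] := sqdist_rate.
apply: (@squeeze_cvgr _ _ _ _ (fun=> 0) (fun k => K1 * k.+1%:R `^ (- (2 * alpha)))).
- by apply: nearW => k; rewrite rate andbT; apply: Ex_ge0 => w; exact: sqdist_ge0.
- exact: cvg_cst.
- rewrite -(mulr0 K1); apply: cvgMr.
  have := @powRN_cvg0 R (2 * alpha) ltac:(by rewrite mulr_gt0).
  by rewrite -(cvg_shiftS (fun k : nat => k%:R `^ (- (2 * alpha)))).
Qed.

(** The squared distances have a summable mean variation and a mean that tends to
[0]. *)
Lemma dist_cvg0 : {ae P, forall w, dist (x k w) (solVI G) @[k --> \oo] --> (0 : R)}.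
Proof.
have [S SP] := sqdist_summable_variation.
have := @ae_cvg_of_summable_variation _ _ _ P (fun k => sqdist k.+1) S
  (fun k w => sqdist_ge0 k.+1 w) (fun k => L1_sqdist k.+1) SP Ex_sqdist_cvg0.
apply: filterS => w cvD.
rewrite (_ : (fun k => _) = fun k => Num.sqrt (sqdist k w)).
  rewrite -(sqrtr0 R); apply: continuous_cvg; first exact: sqrt_continuous.
  by rewrite -(cvg_shiftS (fun k => sqdist k w)).
apply/funext => k; rewrite /sqdist sqrtr_sqr ger0_norm//.
by rewrite dist_pproj// sqrtr_ge0.
Qed.

End iterates.

(** * The convergence theorem *)

Lemma quadratic_growth_le d (T : measurableType d) (R : realType)
    (P : probability T R) (N m : nat) (n : 'I_N -> nat) (G : game P n m)
    (a b : R) : a <= b -> quadratic_growth G b -> quadratic_growth G a.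
Proof.
move=> ab hb x y Xx Sy; apply: le_trans (hb x y Xx Sy).
by rewrite ler_wpM2r ?sqr_ge0.
Qed.

Theorem theorem4p5 (R : realType) (d : measure_display) (T : measurableType d)
    (P : probability T R) (N m : nat) (n : 'I_N -> nat) (G : game P n m)
    (O : forall i : 'I_N, set 'rV[R]_(n i)) (p : 'I_N -> R)
    (sel : nat -> T -> 'I_N) (zeta : nat -> {RV P >-> borel 'rV[R]_m})
    (x : nat -> T -> profile R n) (Mw MF : 'I_N -> R) (alpha dt : R)
    (hA : assumptionA G O) (hS : sagr G sel zeta x p)
    (hC : assumptionC G sel zeta x Mw MF)
    (halpha : 0 < alpha) (hQG : quadratic_growth G alpha)
    (hdt : 0 < dt < 1 / 2) :
  let pmin := \big[Num.min/1]_(i < N) p i in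
  let Edist2 k := 'E_P[(fun w => dist (x k w) (solVI G) ^+ 2)%R]%E in
  {ae P, forall w, dist (x k w) (solVI G) @[k --> \oo] --> (0 : R)} /\
  [/\ 2 * alpha > 1 / 2 - dt ->
        exists2 r : nat -> R^o,
          r =o_\oo (fun k : nat => k%:R `^ (- (1 / 2) + dt) : R^o) &
          \forall k \near \oo, (Edist2 k.+1 <=
            ((3 + 8 * \sum_(i < N) Mw i ^+ 2 + 11 * \sum_(i < N) MF i ^+ 2) /
              (pmin ^+ 2 * (2 * alpha - 1 / 2 + dt) * k%:R `^ (1 / 2 - dt))
             + r k)%:E)%E,
      2 * alpha = 1 / 2 - dt ->
        exists2 b : nat -> R^o,
          b =O_\oo (fun k : nat => k%:R `^ (- (2 * alpha)) * ln k%:R : R^o) &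
          \forall k \near \oo, Edist2 k.+1 = (b k)%:E &
      2 * alpha < 1 / 2 - dt ->
        exists2 b : nat -> R^o,
          b =O_\oo (fun k : nat => k%:R `^ (- (2 * alpha)) : R^o) &
          \forall k \near \oo, Edist2 k.+1 = (b k)%:E].
Proof.
move=> pmin Edist2.
case/andP: hdt => dt0 dt12.
have EdE k : Edist2 k = (Ex P (sqdist G x k))%:E.
  rewrite /Edist2 unlock -Ex_EFin//.
  exact: (L1_sqdist hA hS hC halpha hQG).
have e0 k : 0 <= Ex P (sqdist G x k) by apply: Ex_ge0 => w; exact: sqdist_ge0.
have near_rate (a : R) : 0 < a -> 2 * a < 1 / 2 -> quadratic_growth G a ->
    exists2 K : R, 0 < K &
    \forall k \near \oo, Ex P (sqdist G x k.+1) <= K * k%:R `^ (- (2 * a)).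
  move=> a0 a12 qa; have [K rate] := sqdist_rate hA hS hC a0 qa a12.
  have K0 : 0 <= K by have := rate 0%N; rewrite powR1 mulr1; exact: le_trans.
  exists (K + 1); first by rewrite ltr_wpDl.
  near=> k; apply: le_trans (rate k) _.
  have k0 : 0 < k%:R :> R by rewrite ltr0n; near: k; exact: nbhs_infty_gt.
  apply: ler_pM; [exact: K0|exact: powR_ge0|by rewrite lerDl|].
  rewrite !powRN lef_pV2 ?posrE ?powR_gt0//.
  by rewrite ge0_ler_powR ?nnegrE ?mulr_ge0 ?(ltW a0)// ler_nat.
(* Quadratic growth also holds with the smaller coefficient [a], which is chosen
   so that [2 * a] lies below [1 / 2], as the rate of decay requires, and above
   [1 / 2 - dt] as soon as [2 * alpha] does. *)
pose a := Num.min alpha (1 / 4 - dt / 4).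
have a0 : 0 < a by rewrite lt_min halpha/=; lra.
have a12 : 2 * a < 1 / 2.
  by apply: (@le_lt_trans _ _ (2 * (1 / 4 - dt / 4))); [rewrite ler_wpM2l// ge_min lexx orbT|lra].
have qa : quadratic_growth G a by apply: quadratic_growth_le hQG; rewrite ge_min lexx.
split; first exact: (dist_cvg0 hA hS hC a0 qa a12).
split.
(* Here the mean is of order [k `^ (- 2 * a)] with [2 * a > 1 / 2 - dt], so it is
   itself a remainder of the required order. *)
- move=> h; exists (fun k => Ex P (sqdist G x k.+1)).
    have [K K0 rate] := near_rate a a0 a12 qa.
    have t0 : 0 < 2 * a - (1 / 2 - dt).
      suff : (1 / 2 - dt) / 2 < a by lra.
      by rewrite lt_min; apply/andP; split; lra.
    apply/eqoP => eps eps0.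
    have := @powRN_cvg0 R _ t0.
    move=> /cvgrPdist_lt/(_ (eps / K)); rewrite divr_gt0// => /(_ isT) cv.
    near=> k.
    have k0 : 0 < k%:R :> R by rewrite ltr0n; near: k; exact: nbhs_infty_gt.
    have rk : Ex P (sqdist G x k.+1) <= K * k%:R `^ (- (2 * a)) by near: k.
    have ck : `|0 - k%:R `^ (- (2 * a - (1 / 2 - dt)))| < eps / K by near: k.
    rewrite ger0_norm// ger0_norm ?powR_ge0//; apply: le_trans rk _.
    rewrite (_ : - (2 * a) = - (2 * a - (1 / 2 - dt)) + (- (1 / 2) + dt)); last by ring.
    rewrite powRD; last by apply/implyP; rewrite (gt_eqF k0).
    rewrite mulrA ler_wpM2r ?powR_ge0// mulrC -ler_pdivlMr//.
    by apply: le_trans (ltW ck); rewrite sub0r normrN ler_norm.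
  apply: nearW => k; rewrite EdE lee_fin lerDr.
  rewrite divr_ge0//.
    rewrite addr_ge0 ?addr_ge0// mulr_ge0// sumr_ge0// => i _; exact: sqr_ge0.
  rewrite mulr_ge0 ?powR_ge0// mulr_ge0 ?sqr_ge0//; lra.
- move=> h; exists (fun k => Ex P (sqdist G x k.+1)); last first.
    by apply: nearW => k; rewrite EdE.
  have [|K K0 rate] := near_rate alpha halpha _ hQG; first by rewrite h; lra.
  apply/eqO_exP; exists K => //; near=> k.
  have k0 : 0 < k%:R :> R by rewrite ltr0n; near: k; exact: nbhs_infty_gt.
  have rk : Ex P (sqdist G x k.+1) <= K * k%:R `^ (- (2 * alpha)) by near: k.
  have lk : 1 <= ln k%:R :> R.
    rewrite -[leLHS]expRK ler_ln ?posrE ?expR_gt0//.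
    by near: k; exact: nbhs_infty_ger.
  rewrite ger0_norm// normrM (ger0_norm (powR_ge0 _ _)); apply: le_trans rk _.
  by rewrite ler_wpM2l ?(ltW K0)// ler_peMr ?powR_ge0// (le_trans lk)// ler_norm.
- move=> h; exists (fun k => Ex P (sqdist G x k.+1)); last first.
    by apply: nearW => k; rewrite EdE.
  have [|K K0 rate] := near_rate alpha halpha _ hQG; first by lra.
  apply/eqO_exP; exists K => //; near=> k.
  have rk : Ex P (sqdist G x k.+1) <= K * k%:R `^ (- (2 * alpha)) by near: k.
  by rewrite ger0_norm// ger0_norm ?powR_ge0.
Unshelve. all: by end_near. Qed.
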